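(* Let $n$ and $N$ be positive integers, let $\mathbb{F}\subset\mathbb{C}$ be a field, and let $p_1,\dots,p_n,q_1,\dots,q_n$ be positive integers such that (i) $p_1<\dots<p_n$; (ii) $p_i+q_i=N$ for all $i=1,\dots,n$; (iii) $p_i\neq q_j$ for all $i,j\in\{1,\dots,n\}$ with $i\neq j$. Assume that $f_1,\dots,f_n,g_1,\dots,g_n\colon\mathbb{F}\to\mathbb{C}$ are additive functions, none of them identically zero, satisfying \[ \sum_{i=1}^{n} f_i(x^{p_i})\,g_i(x)^{q_i}=0\qquad\text{for every }x\in\mathbb{F}. \] Then all the functions $f_1,\dots,f_n$ and $g_1,\dots,g_n$ are decomposable functions on the multiplicative group $\mathbb{F}^{\times}$; that is, all of them (restricted to $\mathbb{F}^\times$) are generalized exponential polynomials on $\mathbb{F}^{\times}$.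
   Context: A function $f\colon\mathbb{F}\to\mathbb{C}$ is additive if $f(x+y)=f(x)+f(y)$ for all $x,y\in\mathbb{F}$. $\mathbb{F}^\times$ is the multiplicative group of $\mathbb{F}$. Decomposable functions: for a group $G$ and an integer $k\ge 2$, a function $F\colon G^k\to\mathbb{C}$ is decomposable if it is a finite sum of products $F_1\cdots F_s$ ($s\geq 2$) where the factors $F_1,\dots,F_s$ depend on pairwise disjoint nonempty sets of variables. Equivalently, $F=\sum_E\sum_j A_j^E B_j^E$ (finite sums), where $E$ runs through the nonempty proper subsets of $\{1,\dots,k\}$, $A_j^E$ depends only on the variables $x_i$ with $i\in E$ and $B_j^E$ only on those with $i\notin E$. A function $f\colon G\to\mathbb{C}$ on a commutative group $G$ (written multiplicatively) is called decomposable if there is an integer $k\ge2$ such that $(x_1,\dots,x_k)\mapsto f(x_1\cdots x_k)$ is decomposable on $G^k$. Generalized exponential polynomials: for a commutative group $G$, a generalized polynomial is a function $p\colon G\to\mathbb{C}$ of the form $p(x)=\sum_{k=0}^{r}A_k(x,\dots,x)$ where each $A_k\colon G^k\to\mathbb{C}$ is symmetric and a homomorphism from $G$ to $(\mathbb{C},+)$ in each variable ($A_0$ is a constant). An exponential is a function $m\colon G\to\mathbb{C}$ with $m(xy)=m(x)m(y)$ for all $x,y\in G$. A generalized exponential polynomial is a finite linear combination of functions $p\cdot m$ with $p$ a generalized polynomial and $m$ an exponential. *)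

(* Defs.v *)
From HB Require Import structures.
From mathcomp Require Import all_boot all_order all_fingroup all_algebra.
From mathcomp Require Import reals.
From mathcomp Require Import complex.

Set Implicit Arguments.
Unset Strict Implicit.
Unset Printing Implicit Defensive.

Import GRing.Theory.
Local Open Scope ring_scope.

(* A subfield of a field K is a predicate F : divringClosed K, that is, a
   subset containing 1 and closed under x - y and x / y (with x / 0 = 0 in
   MathComp).  [subfield F] is this subset as a field in its own right. *)
Section Subfield.
Variables (K : fieldType) (F : divringClosed K).

Record subfield := Subfield {
  subfield_val : K;
  subfield_valP : subfield_val \in F
}.

HB.instance Definition _ := [isSub for subfield_val].
HB.instance Definition _ := [Choice of subfield by <:].
HB.instance Definition _ :=
  [SubChoice_isSubIntegralDomain of subfield by <:].
HB.instance Definition _ := [SubIntegralDomain_isSubField of subfield by <:].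
End Subfield.

Section MultiplicativeGroup.
Variable K : fieldType.

Record mulgroup := MulGroup {
  mulgroup_val : K;
  mulgroup_neq0 : mulgroup_val != 0
}.

HB.instance Definition _ := [isSub for mulgroup_val].
HB.instance Definition _ := [Choice of mulgroup by <:].

Definition mulgroup_one := MulGroup (oner_neq0 K).

Definition mulgroup_mul (x y : mulgroup) :=
  MulGroup (mulf_neq0 (mulgroup_neq0 x) (mulgroup_neq0 y)).

Definition mulgroup_inv (x : mulgroup) :=
  MulGroup (invr_neq0 (mulgroup_neq0 x)).

Lemma mulgroup_mulA : associative mulgroup_mul.
Proof. by move=> x y z; apply/val_inj/mulrA. Qed.

Lemma mulgroup_mul1 : left_id mulgroup_one mulgroup_mul.
Proof. by move=> x; apply/val_inj/mul1r. Qed.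

Lemma mulgroup_mul1r : right_id mulgroup_one mulgroup_mul.
Proof. by move=> x; apply/val_inj/mulr1. Qed.

Lemma mulgroup_mulV : left_inverse mulgroup_one mulgroup_inv mulgroup_mul.
Proof. by move=> x; apply/val_inj/mulVf/mulgroup_neq0. Qed.

Lemma mulgroup_mulVr : right_inverse mulgroup_one mulgroup_inv mulgroup_mul.
Proof. by move=> x; apply/val_inj/mulfV/mulgroup_neq0. Qed.

HB.instance Definition _ := isGroup.Build mulgroup
  mulgroup_mulA mulgroup_mul1 mulgroup_mul1r mulgroup_mulV mulgroup_mulVr.

Lemma mulgroup_mulC : forall x y : mulgroup, (x * y = y * x)%g.
Proof. by move=> x y; apply/val_inj/mulrC. Qed.
End MultiplicativeGroup.

(* The complex numbers are R[i] for R a model of the real numbers.  The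
   notions below are meant for a commutative group G. *)
Section Functions.
Variables (R : realType) (G : groupType).
Notation C := R[i].

Definition depends_only_on (k : nat) (E : {set 'I_k})
    (F : ('I_k -> G) -> C) : Prop :=
  forall x y : 'I_k -> G, {in E, x =1 y} -> F x = F y.

Definition split_product (k : nat) (F : ('I_k -> G) -> C) : Prop :=
  exists s : nat, (2 <= s)%N /\
  exists (E : 'I_s -> {set 'I_k}) (H : 'I_s -> ('I_k -> G) -> C),
  [/\ forall j, E j != set0,
      forall j j', j != j' -> [disjoint E j & E j'],
      forall j, depends_only_on (E j) (H j) &
      forall x, F x = \prod_(j < s) H j x].

Definition decomposable_multi (k : nat) (F : ('I_k -> G) -> C) : Prop :=
  exists (m : nat) (T : 'I_m -> ('I_k -> G) -> C),
    (forall t, split_product (T t)) /\ (forall x, F x = \sum_(t < m) T t x).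

Definition decomposable (f : G -> C) : Prop :=
  exists k : nat, (2 <= k)%N /\
    decomposable_multi (fun x : 'I_k -> G => f (\prod_(i < k) x i)%g).

Definition symmetric_multi (k : nat) (A : ('I_k -> G) -> C) : Prop :=
  forall (s : 'S_k) (x : 'I_k -> G), A (x \o s) = A x.

Definition hom_in_each_variable (k : nat) (A : ('I_k -> G) -> C) : Prop :=
  forall (x : 'I_k -> G) (i : 'I_k) (u v : G),
    A [eta x with i |-> (u * v)%g] =
    A [eta x with i |-> u] + A [eta x with i |-> v].

Definition generalized_polynomial (p : G -> C) : Prop :=
  exists (r : nat) (A : forall k : nat, ('I_k -> G) -> C),
    (forall k, symmetric_multi (A k) /\ hom_in_each_variable (A k)) /\
    (forall x, p x = \sum_(k < r.+1) A k (fun=> x)).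

(* The zero function is allowed. *)
Definition exponential (m : G -> C) : Prop :=
  forall x y : G, m (x * y)%g = m x * m y.

Definition generalized_exponential_polynomial (f : G -> C) : Prop :=
  exists (l : nat) (c : 'I_l -> C) (p m : 'I_l -> G -> C),
    [/\ forall j, generalized_polynomial (p j),
        forall j, exponential (m j) &
        forall x, f x = \sum_(j < l) c j * (p j x * m j x)].
End Functions.

Definition restrict_mulgroup (R : realType) (K : fieldType) (f : K -> R[i]) :
  mulgroup K -> R[i] := fun x => f (val x).

(* Main.v *)
(* Proof idea.  Polarizing the equation gives an identity in N variables,
     sum_(i, E) w(i, E) f_i(prod_(j in E) x_j) prod_(j notin E) g_i(x_j) = 0,
   where E ranges over the p_i-element sets of variables.  Choose points e_l
   and functions c_l with g_i(u) = sum_l c_l(u) g_i(e_l); the operator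
   D_u h = h(u .) - sum_l c_l(u) h(e_l .) kills every g_i at 1.  Applying D in
   p_i variables leaves only the terms whose E contains all of them, so by
   downward induction on i a combination of f_i with exponential polynomials
   is annihilated by all p_i-fold products of the D_u.  When p_i >= 2 this
   forces f_i to be an exponential polynomial: a finite-dimensional eigenvalue
   argument, uniform in the function, produces characters chi_1, ..., chi_L
   such that all products of the T_(x_k) - chi_k(x_k) kill f_i.
   If some function h among the remaining ones (the g_i, and f_i if p_i = 1)
   is not an exponential polynomial, write all of them as multiples of h modulo
   a subspace V containing the exponential polynomials but not h, and compare
   the coefficients of h in suitable sets of variables; the hypothesis
   p_i <> q_j excludes the only case in which these terms could cancel. *)
Require Import Defs.
From HB Require Import structures.
From mathcomp Require Import all_boot all_order all_fingroup all_algebra.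
From mathcomp Require Import reals.
From mathcomp Require Import complex.
From mathcomp Require Import boolp functions ring.

Set Implicit Arguments.
Unset Strict Implicit.
Unset Printing Implicit Defensive.

Import GRing.Theory.
Local Open Scope ring_scope.

(** * Subspaces modulo which commuting operators have a finite spectrum *)

Section Subspaces.
Variables (C : fieldType) (E : lmodType C).

Definition subspace (Y : E -> Prop) : Prop :=
  Y 0 /\ forall a x y, Y x -> Y y -> Y (a *: x + y).

Definition span_mod (Y : E -> Prop) (d : nat) (v : 'I_d -> E) (x : E) : Prop :=
  exists a : 'I_d -> C, Y (x - \sum_i a i *: v i).

Variable Y : E -> Prop.
Hypothesis subY : subspace Y.

Lemma subspace0 : Y 0. Proof. by case: subY. Qed.

Lemma subspaceP a x y : Y x -> Y y -> Y (a *: x + y).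
Proof. by case: subY => _; apply. Qed.

Lemma subspaceD x y : Y x -> Y y -> Y (x + y).
Proof. by move=> ? ?; rewrite -[x]scale1r; apply: subspaceP. Qed.

Lemma subspaceZ a x : Y x -> Y (a *: x).
Proof.
by move=> ?; rewrite -[_ *: _]addr0; apply: subspaceP => //; apply: subspace0.
Qed.

Lemma subspaceN x : Y x -> Y (- x).
Proof. by rewrite -scaleN1r; apply: subspaceZ. Qed.

Lemma subspaceB x y : Y x -> Y y -> Y (x - y).
Proof. by move=> ? /subspaceN; apply: subspaceD. Qed.

Lemma subspace_sum (I : Type) (r : seq I) (P : pred I) (F : I -> E) :
  (forall i, P i -> Y (F i)) -> Y (\sum_(i <- r | P i) F i).
Proof.
by move=> YF; apply: (big_ind Y) => //; [exact: subspace0 | exact: subspaceD].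
Qed.

Lemma subspace_subZ a b x : Y (a *: x - b *: x) -> ~ Y x -> a = b.
Proof.
rewrite -scalerBl => Yx nYx; apply/eqP; rewrite -subr_eq0; apply/eqP.
apply: contrapT => /eqP ab; apply: nYx.
by rewrite -[x]scale1r -(mulVf ab) -scalerA; apply: subspaceZ.
Qed.

Lemma sub_span_mod d (v : 'I_d -> E) x : Y x -> span_mod Y v x.
Proof.
by exists (fun=> 0); rewrite big1 ?subr0 // => i _; rewrite scale0r.
Qed.

Lemma mem_span_mod d (v : 'I_d -> E) i : span_mod Y v (v i).
Proof.
exists (fun j => (j == i)%:R); rewrite (bigD1 i) //= eqxx scale1r opprD addrA.
rewrite subrr sub0r big1 ?oppr0; first exact: subspace0.
by move=> j /negbTE->; rewrite scale0r.
Qed.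

Lemma span_mod_subspace d (v : 'I_d -> E) : subspace (span_mod Y v).
Proof.
split=> [|a x y [b Yb] [c Yc]]; first by apply/sub_span_mod/subspace0.
exists (fun i => a * b i + c i).
have -> : \sum_i (a * b i + c i) *: v i =
    a *: (\sum_i b i *: v i) + \sum_i c i *: v i.
  rewrite scaler_sumr -big_split; apply: eq_bigr => i _.
  by rewrite scalerDl scalerA.
by rewrite opprD addrACA -scalerBr; apply: subspaceP.
Qed.

Lemma span_mod_eqmod d (v : 'I_d -> E) x y :
  Y (x - y) -> span_mod Y v x -> span_mod Y v y.
Proof.
move=> Yxy [a Ya]; exists a; have := subspaceB Ya Yxy.
by rewrite opprB addrC addrA subrK.
Qed.

Lemma span_mod_drop d (v : 'I_d.+1 -> E) (b : 'I_d.+1 -> C) (i : 'I_d.+1) x :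
    b i != 0 -> Y (\sum_j b j *: v j) ->
  span_mod Y v x -> span_mod Y (fun k => v (lift i k)) x.
Proof.
move=> bi Yb [a Ya]; pose t := a i / b i.
exists (fun k => a (lift i k) - t * b (lift i k)).
have -> : \sum_k (a (lift i k) - t * b (lift i k)) *: v (lift i k) =
    \sum_j (a j - t * b j) *: v j.
  by rewrite [RHS](bigD1_ord i) //= /t divfK // subrr scale0r add0r.
have -> : \sum_j (a j - t * b j) *: v j =
    \sum_j a j *: v j - t *: \sum_j b j *: v j.
  rewrite scaler_sumr -sumrB; apply: eq_bigr => j _.
  by rewrite scalerBl scalerA.
by rewrite opprB addrA addrAC addrC; apply: subspaceP.
Qed.

Lemma span_mod_sub d (v : 'I_d -> E) (W : E -> Prop) :
    subspace W -> (forall x, Y x -> W x) -> (forall i, W (v i)) ->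
  forall x, span_mod Y v x -> W x.
Proof.
move=> [W0 WP] YW Wv x [a /YW Wx]; rewrite -(subrK (\sum_i a i *: v i) x).
rewrite -[x - _]scale1r; apply: (WP) => //.
apply: (big_ind W) => // [y z ? ?|i _]; first by rewrite -[y]scale1r; apply: WP.
by rewrite -[_ *: _]addr0; apply: WP.
Qed.

Lemma add_line_subspace (x : E) : subspace (fun z => exists b, Y (z - b *: x)).
Proof.
split=> [|a z w [b Yb] [c Yc]].
  by exists 0; rewrite scale0r subr0; apply: subspace0.
exists (a * b + c); rewrite scalerDl opprD addrACA -scalerA -scalerBr.
exact: subspaceP.
Qed.
End Subspaces.

(** The normalization at 1 excludes the zero function, which [exponential] admits, and makes a
    character nowhere zero. *)
Definition character (C : fieldType) (G : groupType) (chi : G -> C) : Prop :=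
  chi 1%g = 1 /\ forall g h, chi (g * h)%g = chi g * chi h.

Fixpoint characters (C : fieldType) (G : groupType) (s : seq (G -> C)) : Prop :=
  if s is chi :: s' then character chi /\ characters s' else True.

Lemma characters_cat (C : fieldType) (G : groupType) (s1 s2 : seq (G -> C)) :
  characters (s1 ++ s2) <-> characters s1 /\ characters s2.
Proof. by elim: s1 => [|chi s1 IH] /=; rewrite ?IH; tauto. Qed.

(** * Joint eigenvectors and generalized eigenspaces of a commuting family *)

Section Spectrum.
Variables (C : numClosedFieldType) (G : groupType) (E : lmodType C).
Variable T : G -> {linear E -> E}.

Definition stable (Y : E -> Prop) : Prop := forall g x, Y x -> Y (T g x).

(** A generalized joint eigenspace modulo [Y] when [s] is constant. Each entry of [s] has its own
    group element, chosen independently of the others. *)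
Fixpoint kills (Y : E -> Prop) (s : seq (G -> C)) (x : E) : Prop :=
  if s is chi :: s' then forall g, kills Y s' (T g x - chi g *: x) else Y x.

Lemma kills_cat Y s1 s2 x : kills Y (s1 ++ s2) x <-> kills (kills Y s2) s1 x.
Proof.
by elim: s1 x => //= chi s1 IH x; split=> kx g; apply/IH.
Qed.

Lemma kills_sub (Y Y' : E -> Prop) s :
  (forall x, Y x -> Y' x) -> forall x, kills Y s x -> kills Y' s x.
Proof. by move=> sYY'; elim: s => //= chi s IH x kx g; apply/IH/kx. Qed.

Hypothesis T1 : forall x, T 1%g x = x.
Hypothesis TM : forall g h x, T (g * h)%g x = T g (T h x).
Hypothesis TC : forall g h x, T g (T h x) = T h (T g x).

Lemma kills_subspace Y s : subspace Y -> subspace (kills Y s).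
Proof.
move=> subY; elim: s => //= chi s IH; split=> [g|a x y kx ky g].
  by rewrite raddf0 scaler0 subrr; case: IH.
rewrite linearP scalerDr scalerA opprD addrACA [chi g * a]mulrC -scalerA.
by rewrite -scalerBr; apply: subspaceP.
Qed.

Lemma kills_stable Y s : stable Y -> stable (kills Y s).
Proof.
move=> stY; elim: s => //= chi s IH h x kx g.
by rewrite TC -linearZ -raddfB; apply/IH/kx.
Qed.

Lemma sub_kills Y s :
  subspace Y -> stable Y -> forall x, Y x -> kills Y s x.
Proof.
move=> subY stY; elim: s => //= chi s IH x Yx g.
by apply: IH; apply: subspaceB => //; [apply: stY | apply: subspaceZ].
Qed.

Lemma span_mod_stable Y d (v : 'I_d -> E) : subspace Y -> stable Y ->
  (forall g i, span_mod Y v (T g (v i))) -> stable (span_mod Y v).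
Proof.
move=> subY stY Wv g x [a Ya]; have subW := span_mod_subspace subY v.
apply: (span_mod_eqmod subY (x := T g (\sum_i a i *: v i))).
  by rewrite -raddfB; apply: stY; rewrite -opprB; apply: subspaceN.
rewrite raddf_sum; apply: subspace_sum => // i _.
by rewrite /= linearZ /=; apply: subspaceZ.
Qed.

(* If some T g is not scalar on W modulo Y, pick an eigenvalue l of T g: then
   (T g - l) W + Y is stable, not contained in Y, and needs fewer generators. *)
Lemma common_eigenvector Y d (v : 'I_d -> E) :
    subspace Y -> stable Y -> stable (span_mod Y v) ->
    (exists x, span_mod Y v x /\ ~ Y x) ->
  exists chi x, [/\ span_mod Y v x, ~ Y x & forall g, Y (T g x - chi g *: x)].
Proof.
move=> subY stY.
elim: d v => [|d IHd] v stW [x0 [Wx0 nYx0]].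
  by case: nYx0; case: Wx0 => a; rewrite big_ord0 subr0.
have subW := span_mod_subspace subY v.
case: (pselect (forall g, exists l, forall x, span_mod Y v x ->
    Y (T g x - l *: x))) => [/choice[chi chiP]|].
  by exists chi, x0; split=> // g; apply: chiP.
move/existsNP => [g /forallNP ng].
have /choice[a Ya] : forall i, exists a : 'I_d.+1 -> C,
    Y (T g (v i) - \sum_j a j *: v j).
  by move=> i; apply/stW/mem_span_mod.
pose M := \matrix_(i, j) a i j.
have [l /eigenvalueP[u uM u0]] := @eigenvalue_closed C _ M isT.
have [i ui] : exists i, u 0 i != 0.
  apply: contrapT => /forallNP nu; case/eqP: u0; apply/rowP => i.
  by rewrite mxE; apply: contrapT => /eqP; apply: nu.
pose w j := T g (v j) - l *: v j.
have Yuw : Y (\sum_j u 0 j *: w j).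
  have -> : \sum_j u 0 j *: w j =
      \sum_j u 0 j *: (T g (v j) - \sum_k a j k *: v k).
    rewrite /w.
    under eq_bigr do rewrite scalerBr.
    under [RHS]eq_bigr do rewrite scalerBr.
    rewrite !sumrB; congr (_ - _).
    under [RHS]eq_bigr do rewrite scaler_sumr.
    rewrite exchange_big /=; apply: eq_bigr => k _.
    under eq_bigr do rewrite scalerA.
    rewrite -scaler_suml scalerA; congr (_ *: _).
    have := congr1 (fun A : 'rV_d.+1 => A 0 k) uM; rewrite !mxE mulrC => <-.
    by apply: eq_bigr => j _; rewrite !mxE.
  by apply: subspace_sum => // j _; apply: subspaceZ.
have image x : span_mod Y v x ->
    span_mod Y (fun k => w (lift i k)) (T g x - l *: x).
  move=> [b Yb]; apply: (span_mod_drop subY ui Yuw); exists b.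
  have -> : \sum_j b j *: w j = T g (\sum_j b j *: v j) - l *: \sum_j b j *: v j.
    rewrite raddf_sum scaler_sumr -sumrB; apply: eq_bigr => j _ /=.
    by rewrite linearZ scalerBr !scalerA [l * _]mulrC.
  rewrite opprD addrACA -opprD -scalerBr -[T g x - _]raddfB.
  by apply: subspaceB => //; [apply: stY | apply: subspaceZ].
have W'W x : span_mod Y (fun k => w (lift i k)) x -> span_mod Y v x.
  apply: span_mod_sub => // [y|k]; first exact: sub_span_mod.
  have Wv := mem_span_mod subY v (lift i k).
  by apply: subspaceB => //; [apply: stW | apply: subspaceZ].
have [||chi [x [W'x nYx xchi]]] := IHd (fun k => w (lift i k)).
- move=> h z [b Yb]; pose x := \sum_k b k *: v (lift i k).
  have xz : T g x - l *: x = \sum_k b k *: w (lift i k).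
    rewrite raddf_sum scaler_sumr -sumrB; apply: eq_bigr => j _ /=.
    by rewrite linearZ scalerBr !scalerA [l * _]mulrC.
  apply: (@span_mod_eqmod _ _ _ subY _ _ (T g (T h x) - l *: T h x)).
    rewrite TC -linearZ -!raddfB xz; apply: stY.
    by rewrite -opprB; apply: subspaceN.
  apply: image; apply: stW; apply: subspace_sum => // k _.
  by apply: subspaceZ => //; apply: mem_span_mod.
- have [x /not_implyP[Wx nY]] := (existsNP _).2 (ng l).
  by exists (T g x - l *: x); split=> //; apply: image.
by exists chi, x; split=> //; apply: W'W.
Qed.

(** Adjoining a common eigenvector [x] to [Y] lowers the number of generators by one. By induction a
    list [s] carries the span into [Y + C x], and the eigenvalue function [chi] of [x] then carries
    this into [Y]. *)
Lemma span_kills Y d (v : 'I_d -> E) :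
    subspace Y -> stable Y -> stable (span_mod Y v) ->
  exists s : seq (G -> C), characters s /\
    forall x, span_mod Y v x -> kills Y s x.
Proof.
elim: d Y v => [|d IHd] Y v subY stY stW.
  by exists [::]; split=> // x [a]; rewrite big_ord0 subr0.
case: (pselect (exists x, span_mod Y v x /\ ~ Y x)) => [ex|nex]; last first.
  exists [::]; split=> // x Wx /=; apply: contrapT => nYx.
  by apply: nex; exists x.
have [chi [x [Wx nYx xchi]]] := common_eigenvector subY stY stW ex.
have subW := span_mod_subspace subY v.
(* Comparing [T (g * h) x] with [T g (T h x)] modulo [Y] gives multiplicativity, because [x] is not
   in [Y]. *)
have chi_char : character chi.
  split=> [|g h]; apply: (subspace_subZ subY _ nYx).
    have := subspaceN subY (xchi 1%g); rewrite opprB T1 => Y1.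
    by rewrite scale1r.
  have := subspaceZ subY (chi h) (xchi g).
  have := stY g _ (xchi h); rewrite raddfB /= linearZ -TM => Y1.
  rewrite scalerBr scalerA [_ * chi g]mulrC => Y2.
  have := subspaceB subY (subspaceD subY Y1 Y2) (xchi (g * h)%g).
  by rewrite addrA subrK opprB [X in Y X -> _]addrC addrA subrK.
pose Y' z := exists b, Y (z - b *: x).
have subY' : subspace Y' := add_line_subspace subY x.
have YY' z : Y z -> Y' z by exists 0; rewrite scale0r subr0.
have [a Ya] := Wx.
have [i ai] : exists i, a i != 0.
  apply: contrapT => /forallNP na; apply: nYx.
  move: Ya; rewrite big1 ?subr0 // => i _.
  by have /negP/negPn/eqP-> := na i; rewrite scale0r.
have Y'x : Y' x by exists 1; rewrite scale1r subrr; apply: subspace0.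
have Y'a : Y' (\sum_j a j *: v j).
  rewrite -(subKr x (\sum_j _)); apply: subspaceB => //; exact: YY'.
have WE z : span_mod Y v z <-> span_mod Y' (fun k => v (lift i k)) z.
  split=> [[b Yb]|].
    by apply: (span_mod_drop subY' ai Y'a); exists b; apply: YY'.
  apply: span_mod_sub => // [y [b Yb]|k]; last exact: mem_span_mod.
  rewrite -(subrK (b *: x) y); apply: subspaceD => //.
    exact: sub_span_mod.
  exact: subspaceZ.
have [||s [s_char sP]] := IHd Y' (fun k => v (lift i k)) subY'.
- move=> g z [b Yb]; exists (b * chi g).
  rewrite -(subrK (T g (b *: x)) (T g z)) -addrA; apply: subspaceD => //.
    by rewrite -raddfB; apply: stY.
  by rewrite linearZ /= -scalerA -scalerBr; apply: subspaceZ.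
- by move=> g z /WE Wz; apply/WE/stW.
exists (s ++ [:: chi]); split=> [|z Wz]; first exact/characters_cat.
apply/kills_cat; apply: kills_sub (sP _ ((WE _).1 Wz)) => y [b Yb] g /=.
rewrite -(subrK (T g (b *: x)) (T g y)) -addrA; apply: subspaceD => //.
  by rewrite -raddfB; apply: stY.
rewrite -(subrK (chi g *: (b *: x)) (T g (b *: x))) -addrA.
apply: subspaceD => //; last first.
  by rewrite -scalerBr -opprB; apply: subspaceZ => //; exact: subspaceN.
by rewrite linearZ /= scalerA [chi g * _]mulrC -scalerA -scalerBr; apply: subspaceZ.
Qed.
End Spectrum.

(** * Functions vanishing on powers of a finite-codimensional subspace *)

(** A point of [P] whose row lies outside the row space of the points chosen so far raises the rank,
    which is at most [d]; the induction is on the remaining corank. *)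
Lemma finite_spanning (K : fieldType) (X : Type) (P : X -> Prop) (d : nat)
    (a : X -> 'rV[K]_d) :
  exists (r : nat) (t : 'I_r -> X), (forall l, P (t l)) /\
    forall x, P x -> exists b : 'I_r -> K, a x = \sum_l b l *: a (t l).
Proof.
pose M r (t : 'I_r -> X) := \matrix_l a (t l).
suff step m : forall r (t : 'I_r -> X), (forall l, P (t l)) ->
    (d - \rank (M r t) <= m)%N ->
  exists (r : nat) (t : 'I_r -> X), (forall l, P (t l)) /\
    forall x, P x -> exists b : 'I_r -> K, a x = \sum_l b l *: a (t l).
  have t0 : 'I_0 -> X by case.
  by apply: (step d 0 t0); [case | apply: leq_subr].
elim: m => [|m IHm] r t Pt rk.
all: case: (pselect (exists x, P x /\ ~~ (a x <= M r t)%MS)) => [|nx]; last first.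
1,3: exists r, t; split=> // x Px.
1,2: have /submxP[D aD] : (a x <= M r t)%MS
       by apply: contrapT => /negP nax; apply: nx; exists x.
1,2: exists (fun l => D 0 l); rewrite aD mulmx_sum_row; apply: eq_bigr => l _;
     by rewrite rowK.
  move=> [x [Px /negP[]]]; apply: submx_full.
  by rewrite /row_full eqn_leq rank_leq_col /= -subn_eq0 -leqn0.
move=> [x [Px nax]].
pose t' i := if unlift ord0 i is Some j then t j else x.
have tS j : t' (lift ord0 j) = t j by rewrite /t' liftK.
have t0 : t' ord0 = x by rewrite /t' unlift_none.
apply: (IHm r.+1 t') => [l|]; first by rewrite /t'; case: unlift.
have ltMM' : (M r t < M r.+1 t')%MS.
  rewrite ltmxE; apply/andP; split.
    by apply/row_subP => j; rewrite rowK -tS -[a _](rowK (a \o t')) row_sub.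
  apply: contra nax; apply: submx_trans.
  by rewrite -t0 -[a _](rowK (a \o t')) row_sub.
have := rank_ltmx ltMM'; have := rank_leq_col (M r.+1 t').
move: rk; move: (\rank (M r t)) (\rank (M r.+1 t')) => i j.
by rewrite !leq_subLR => h1 h2 h3; rewrite (leq_trans h1) // addnS -addSn leq_add2r.
Qed.

(** * Translation operators on functions and on families of functions *)

Section Shift.
Variables (R : rcfType) (G : groupType).
Notation C := R[i].
Hypothesis mulgC : forall g h : G, (g * h = h * g)%g.

Definition shift (g : G) (f : G -> C) : G -> C := fun x => f (g * x)%g.

Lemma shift_linear g : linear (shift g).
Proof. by []. Qed.
HB.instance Definition _ g :=
  GRing.isLinear.Build C (G -> C) (G -> C) _ (shift g) (shift_linear g).

(** Translating a whole, possibly infinite, family at once lets [span_kills] produce a single list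
    of characters valid for all its members. *)
Definition fam_shift (Om : Type) (g : G) (F : Om -> G -> C) : Om -> G -> C :=
  fun w => shift g (F w).

Lemma fam_shift_linear Om g : linear (@fam_shift Om g).
Proof. by []. Qed.
HB.instance Definition _ Om g :=
  GRing.isLinear.Build C (Om -> G -> C) (Om -> G -> C) _ (@fam_shift Om g)
    (@fam_shift_linear Om g).

Lemma shift1 f : shift 1%g f = f.
Proof. by apply/funext => x; rewrite /shift mul1g. Qed.

Lemma shiftM g h f : shift (g * h)%g f = shift g (shift h f).
Proof. by apply/funext => x; rewrite /shift mulgA [(g * h)%g]mulgC. Qed.

Lemma shiftC g h f : shift g (shift h f) = shift h (shift g f).
Proof. by rewrite -!shiftM mulgC. Qed.

Lemma fam_shift1 Om (F : Om -> G -> C) : fam_shift 1%g F = F.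
Proof. by apply/funext => w; apply: shift1. Qed.

Lemma fam_shiftM Om g h (F : Om -> G -> C) :
  fam_shift (g * h)%g F = fam_shift g (fam_shift h F).
Proof. by apply/funext => w; apply: shiftM. Qed.

Lemma fam_shiftC Om g h (F : Om -> G -> C) :
  fam_shift g (fam_shift h F) = fam_shift h (fam_shift g F).
Proof. by rewrite -!fam_shiftM mulgC. Qed.

Lemma sum_fctE (X : Type) (V : nmodType) (I : Type) (r : seq I) (P : pred I)
    (f : I -> X -> V) x :
  (\sum_(i <- r | P i) f i) x = \sum_(i <- r | P i) f i x.
Proof. by elim/big_rec2: _ => //= i y z _ <-. Qed.

Definition null (f : G -> C) : Prop := f = 0.

Lemma null_subspace : subspace null.
Proof. by split=> // a x y -> ->; rewrite /null scaler0 addr0. Qed.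

Lemma null_stable : stable shift null.
Proof. by move=> g x ->; rewrite /null raddf0. Qed.

Definition killed (s : seq (G -> C)) : (G -> C) -> Prop := kills shift null s.

(** The working form of an exponential polynomial: [spectral_decomposable] and [spectral_gep]
    convert it into the two notions of the theorem. *)
Definition spectral (f : G -> C) : Prop := exists s, characters s /\ killed s f.

Lemma killed_subspace s : subspace (killed s).
Proof. exact: kills_subspace null_subspace. Qed.

Lemma killed_stable s : stable shift (killed s).
Proof. exact: (kills_stable shiftC) null_stable. Qed.

Lemma killed_catl s1 s2 f : killed s1 f -> killed (s1 ++ s2) f.
Proof.
move=> kf; apply/kills_cat; apply: kills_sub kf => x ->.
exact: subspace0 (killed_subspace s2).
Qed.

Lemma killed_catr s1 s2 f : killed s2 f -> killed (s1 ++ s2) f.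
Proof.
move=> kf; apply/kills_cat; apply: sub_kills kf; first exact: killed_subspace.
exact: killed_stable.
Qed.

Lemma common_killed r (h : 'I_r -> G -> C) : (forall l, spectral (h l)) ->
  exists s, characters s /\ forall l, killed s (h l).
Proof.
elim: r h => [|r IHr] h hP; first by exists [::]; split=> // -[].
have [s [s_char sP]] := IHr (h \o lift ord0) (fun l => hP _).
have [s0 [s0_char s0P]] := hP ord0.
exists (s0 ++ s); split=> [|l]; first exact/characters_cat.
case: (unliftP ord0 l) => [j ->|->]; last exact: killed_catl.
exact/killed_catr/sP.
Qed.

Lemma spectral_stable : stable shift spectral.
Proof.
by move=> g f [s [sc sf]]; exists s; split=> //; apply: killed_stable.
Qed.

Lemma spectral_subspace : subspace spectral.
Proof.
split=> [|a x y [s1 [c1 k1]] [s2 [c2 k2]]]; first by exists [::].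
exists (s1 ++ s2); split; first exact/characters_cat.
apply: subspaceP; [exact: killed_subspace|exact: killed_catl|exact: killed_catr].
Qed.

Lemma fam_kills Om (Y : (G -> C) -> Prop) s (H : Om -> G -> C) :
  kills (@fam_shift Om) (fun F => forall w, Y (F w)) s H ->
  forall w, kills shift Y s (H w).
Proof. by elim: s H => //= chi s IH H kH w g; apply: (IH _ (kH g)). Qed.

Section Points.
Variables (d : nat) (e : 'I_d -> G) (c : 'I_d -> G -> C).

Definition deviation (u : G) (f : G -> C) : G -> C :=
  shift u f - \sum_j c j u *: shift (e j) f.

Lemma deviation_linear u : linear (deviation u).
Proof.
move=> a f h; rewrite /deviation.
have -> : \sum_j c j u *: shift (e j) (a *: f + h) =
    a *: (\sum_j c j u *: shift (e j) f) + \sum_j c j u *: shift (e j) h.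
  rewrite scaler_sumr -big_split; apply: eq_bigr => j _ /=.
  by rewrite linearP.
by rewrite linearP /= opprD addrACA -scalerBr.
Qed.
HB.instance Definition _ u :=
  GRing.isLinear.Build C (G -> C) (G -> C) _ (deviation u) (deviation_linear u).

Lemma deviationE u f x :
  deviation u f x = f (u * x)%g - \sum_j c j u * f (e j * x)%g.
Proof.
rewrite /deviation !fctE sum_fctE; congr (_ - _).
Qed.

(* [deviations p f] says that f, extended linearly to the group algebra,
   vanishes on the p-th power of the space spanned by the elements
   u - \sum_j c j u *: e j. *)
Fixpoint deviations (p : nat) (f : G -> C) : Prop :=
  if p is p'.+1 then forall u, deviations p' (deviation u f) else f 1%g = 0.

(** The hypothesis says that [deviation u f] is a combination of the [c l] with coefficients
    [deviation u f (e l)]. Hence all translates of [f] lie in the span of the [2 d] functions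
    [shift (e j) f] and [c l], and [span_kills] applies with [Y = 0]. *)
Lemma deviations2_spectral f : deviations 2 f -> spectral f.
Proof.
move=> /= f2.
pose a u := row_mx (\row_j c j u) (\row_l deviation u f (e l)).
pose w i := match fintype.split i with inl j => shift (e j) f | inr l => c l end.
have fE u : shift u f = \sum_(i < d + d) a u 0 i *: w i.
  rewrite big_split_ord /= /a /w.
  under eq_bigr => i _ do rewrite row_mxEl mxE (unsplitK (inl i)).
  under [X in _ + X]eq_bigr => i _ do rewrite row_mxEr mxE (unsplitK (inr i)).
  rewrite -[LHS](subrK (\sum_j c j u *: shift (e j) f)) addrC; congr (_ + _).
  apply/funext => v; rewrite sum_fctE; have := f2 u v.
  rewrite deviationE mulg1 => /subr0_eq; rewrite /deviation => ->.
  by apply: eq_bigr => l _; rewrite mulg1 mulrC.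
(* The functions [c l] need not be combinations of translates, so finitely many spanning translates
   are selected: their span is stable. *)
have [r [t [_ tP]]] := finite_spanning (fun=> True) a.
have fS u : span_mod null (fun l => shift (t l) f) (shift u f).
  have [b bP] := tP u I; exists b; apply/eqP; rewrite subr_eq0; apply/eqP.
  under eq_bigr => l _ do rewrite fE scaler_sumr.
  rewrite exchange_big fE; apply: eq_bigr => i _ /=.
  under eq_bigr do rewrite scalerA.
  rewrite -scaler_suml bP summxE; congr (_ *: _).
  by apply: eq_bigr => l _; rewrite mxE.
have [|||s [s_char sP]] := @span_kills _ _ _ shift shift1 shiftM shiftC null r
    (fun l => shift (t l) f).
- exact: null_subspace.
- exact: null_stable.
- apply: span_mod_stable => [||g i]; first exact: null_subspace.
    exact: null_stable.
  by have := fS (g * t i)%g; rewrite shiftM.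
by exists s; split=> //; have := fS 1%g; rewrite shift1; apply: sP.
Qed.

(* The matrix of the translations on the span of the shift (e j) f modulo
   [killed s] does not depend on f, so one list s' serves all f at once: apply
   span_kills to the family of all such f. *)
Lemma killed_deviation s : characters s ->
  exists s', characters s' /\
    forall f, (forall u, killed s (deviation u f)) -> killed s' f.
Proof.
move=> s_char; pose Om := {f | forall u, killed s (deviation u f)}.
pose F : Om -> G -> C := sval.
pose Y (H : Om -> G -> C) := forall w, killed s (H w).
have subY : subspace Y.
  split=> [w|a x y Yx Yy w]; first exact: subspace0 (killed_subspace s).
  by apply: subspaceP; [exact: killed_subspace|apply: Yx|apply: Yy].
have stY : stable (@fam_shift Om) Y by move=> g x Yx w; apply/killed_stable/Yx.
have FS u : span_mod Y (fun j => fam_shift (e j) F) (fam_shift u F).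
  exists (c^~ u) => w; have := svalP w u; congr (killed s (_ - _)).
  by rewrite sum_fctE.
have [|||s' [s'_char s'P]] := @span_kills _ _ _ (@fam_shift Om) (@fam_shift1 Om)
  (@fam_shiftM Om) (@fam_shiftC Om) Y d (fun j => fam_shift (e j) F).
- exact: subY.
- exact: stY.
- apply: span_mod_stable => // g i.
  by have := FS (g * e i)%g; rewrite fam_shiftM.
exists (s' ++ s); split=> [|f fP]; first exact/characters_cat.
apply/kills_cat; have := FS 1%g; rewrite fam_shift1 => /s'P/fam_kills.
by move=> /(_ (exist _ f fP)).
Qed.

(* For p = 0, the functions deviation u f all lie in the finite-dimensional
   space of the spectral h with deviations 1 h, whence a common list. *)
Lemma deviations_killed p : exists s, characters s /\
  forall f, deviations p.+2 f -> killed s f.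
Proof.
elim: p => [|p [s [s_char sP]]]; last first.
  have [s' [s'_char s'P]] := killed_deviation s_char.
  by exists s'; split=> // f fP; apply: s'P => u; apply/sP/fP.
pose P f := deviations 1 f /\ spectral f.
(* By [dE] below, a function with [deviations 1] is determined linearly by its values at the points
   [e j], so finitely many [t l] span all of [P]. *)
pose a (f : G -> C) := \row_j f (e j).
have [r [t [tP tS]]] := finite_spanning P a.
have [s0 [s0_char s0P]] := common_killed (fun l => (tP l).2).
have [s [s_char sP]] := killed_deviation s0_char.
exists s; split=> // f f2; apply: sP => u.
have dE h : deviations 1 h -> h = \sum_j h (e j) *: c j.
  move=> h1; apply/funext => v; rewrite sum_fctE.
  have := h1 v; rewrite /= deviationE mulg1 => /subr0_eq ->.
  by apply: eq_bigr => j _; rewrite mulg1 mulrC.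
have Pu : P (deviation u f).
  split; first exact: f2.
  have [s1 [s1_char s1P]] := deviations2_spectral f2.
  exists s1; split=> //.
  have subs1 := killed_subspace s1.
  apply: subspaceB => //; first exact: killed_stable.
  apply: subspace_sum => // j _; apply: subspaceZ => //; exact: killed_stable.
have [b bP] := tS _ Pu; rewrite (dE _ Pu.1).
under eq_bigr => j _.
  have -> : deviation u f (e j) = \sum_l b l * t l (e j).
    have := congr1 (fun A : 'rV_d => A 0 j) bP; rewrite mxE summxE => ->.
    by apply: eq_bigr => l _; rewrite !mxE.
  rewrite scaler_suml; over.
rewrite exchange_big /=; have subs0 := killed_subspace s0.
apply: subspace_sum => // l _; under eq_bigr do rewrite -scalerA.
by rewrite -scaler_sumr; apply: subspaceZ => //; rewrite -dE //; case: (tP l).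
Qed.
End Points.
End Shift.

(** * Multiplying out products of operators over subsets *)

Lemma sum_subset_setU1 (V : nmodType) (I : finType) (A : {set I}) (a : I)
    (H : {set I} -> V) : a \notin A ->
  \sum_(S : {set I} | S \subset a |: A) H S =
  \sum_(S : {set I} | S \subset A) (H S + H (a |: S)).
Proof.
move=> aA; rewrite big_split /= (bigID (fun S : {set I} => a \in S)) /= addrC.
congr (_ + _).
  apply: eq_bigl => S; apply/andP/idP => [[/subsetP SA aS]|SA].
    apply/subsetP => i iS; have := SA i iS; rewrite in_setU1.
    by case/orP => // /eqP ia; rewrite -ia iS in aS.
  rewrite (subset_trans SA (subsetUr _ _)); split=> //.
  by apply: contra aA => /(subsetP SA).
rewrite (reindex_onto (fun S => a |: S) (fun S => S :\ a)) /=; last first.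
  by move=> S /andP[_ aS]; rewrite setD1K.
apply: eq_bigl => S; rewrite setU11 andbT; apply/andP/idP => [[SA /eqP Sa]|SA].
  apply/subsetP => i; rewrite -Sa in_setD1 => /andP[ia /(subsetP SA)].
  by rewrite in_setU1 (negbTE ia).
rewrite setUS //; split=> //; rewrite setU1K //.
by apply: contra aA => /(subsetP SA).
Qed.

HB.instance Definition _ (K : fieldType) :=
  SemiGroup.isCommutativeLaw.Build (mulgroup K) mulg (@mulgroup_mulC K).

Section Expansion.
Variables (R : rcfType) (K : fieldType).
Notation C := R[i].
Notation G := (mulgroup K).

(** The set [S] collects the indices at which the translation, rather than the scalar, is chosen
    when the product is multiplied out. *)
Lemma foldr_shift_expansion (I : finType) (x : I -> G) (c : I -> C)
    (r : seq I) (f : G -> C) z : uniq r ->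
  foldr (fun i h => shift (x i) h - c i *: h) f r z =
  \sum_(S : {set I} | S \subset [set i in r])
    (\prod_(i in [set i in r] :\: S) - c i) * f ((\prod_(i in S) x i) * z)%g.
Proof.
elim: r z => [|a r IHr] z /=.
  rewrite (big_pred1 set0) => [_|S]; last by rewrite set_nil subset0.
  by rewrite set_nil set0D !big_set0 mul1r mul1g.
case/andP=> ar ur; rewrite set_cons sum_subset_setU1 ?inE //.
set h := foldr _ f r.
transitivity (h (x a * z)%g - c a * h z) => //.
rewrite /h !IHr // mulr_sumr -sumrB; apply: eq_bigr => S SA.
have aS : a \notin S.
  by apply: contra ar => /(subsetP SA); rewrite inE.
have -> : (a |: [set i in r]) :\: S = a |: ([set i in r] :\: S).
  by apply/setP => i; rewrite !inE; case: eqP => // ->; rewrite aS.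
have -> : (a |: [set i in r]) :\: (a |: S) = [set i in r] :\: S.
  apply/setP => i; rewrite !inE; case: eqP => //= ->; rewrite (negbTE ar).
  by rewrite andbF.
rewrite !big_setU1 //= ?inE ?(negbTE ar) ?andbF //.
by rewrite addrC [(x a * \prod_(i in S) x i)%g]mulgroup_mulC mulgA !mulNr mulrA.
Qed.
End Expansion.

(** * Polarization *)

(** Inclusion-exclusion: after complementation, sets with and without a fixed [a] outside [A] cancel
    in pairs. *)
Lemma sum_signs_supset (K : nzRingType) (J : finType) (A : {set J}) :
  \sum_(S : {set J} | A \subset S) (-1) ^+ #|~: S| = (A == setT)%:R :> K.
Proof.
rewrite (reindex_inj (inv_inj (@setCK J))) /=.
have -> : \sum_(S : {set J} | A \subset ~: S) (-1) ^+ #|~: ~: S| =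
    \sum_(S : {set J} | S \subset ~: A) (-1) ^+ #|S| :> K.
  by apply: eq_big => S; rewrite ?setCK // subsetC.
rewrite -[A == setT](inj_eq (@setC_inj J)) setCT.
case: (set_0Vmem (~: A)) => [->|[a aA]].
  rewrite eqxx (big_pred1 set0) => [|S]; last by rewrite subset0.
  by rewrite cards0.
have /negbTE-> : ~: A != set0 by apply/set0Pn; exists a.
rewrite -(setD1K aA) sum_subset_setU1 ?setD11 // big1 // => S SA.
have aS : a \notin S by apply/negP => /(subsetP SA); rewrite setD11.
by rewrite cardsU1 aS exprS mulN1r subrr.
Qed.

Section Polarization.
Variables (T : Type) (idx : T) (op : Monoid.com_law idx) (K : nzRingType).

(** The law [op] is abstract because polarization serves twice: for addition in the field and for
    multiplication in its unit group. *)
Definition multiadditive (k : nat) (A : ('I_k -> T) -> K) : Prop :=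
  forall (x : 'I_k -> T) (i : 'I_k) (u v : T),
    A [eta x with i |-> op u v] = A [eta x with i |-> u] + A [eta x with i |-> v].

Let fcons k (u : T) (x : 'I_k -> T) : 'I_k.+1 -> T :=
  fun i => if unlift ord0 i is Some j then x j else u.

(** The variables are expanded one at a time, starting with the first; [phi] records the entry
    chosen in each of them. *)
Lemma multiadditive_expansion k (A : ('I_k -> T) -> K) (J : finType)
    (y : J -> T) (S : {set J}) : multiadditive A ->
  A (fun=> \big[op/idx]_(j in S) y j) =
  \sum_(phi : {ffun 'I_k -> J} | [forall i, phi i \in S]) A (y \o phi).
Proof.
elim: k A => [|k IHk] A addA.
  pose phi0 : {ffun 'I_0 -> J} := ffun0 (card_ord 0).
  rewrite (big_pred1 phi0) => [|phi].
    by congr A; apply/funext => -[].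
  rewrite /= (_ : phi = phi0) ?eqxx; last by apply/ffunP => -[].
  by apply/forallP => -[].
set b := \big[op/idx]_(j in S) y j.
have consE u v (x : 'I_k -> T) : ([eta fcons v x with ord0 |-> u] : 'I_k.+1 -> T) = fcons u x.
  apply/funext => i /=; rewrite /fcons; case: (unliftP ord0 i) => [j ->|->] //.
have consD x u v : A (fcons (op u v) x) = A (fcons u x) + A (fcons v x).
  by have := addA (fcons u x) ord0 u v; rewrite !consE.
have -> : (fun=> b) = @fcons k b (fun=> b).
  by apply/funext => i; rewrite /fcons; case: unliftP.
have cons0 x : A (fcons idx x) = 0.
  by apply: (addrI (A (fcons idx x))); rewrite -consD addr0 Monoid.mul1m.
rewrite {1}/b (big_morph (fun u => A (fcons u (fun=> b))) (consD _) (cons0 _)).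
under eq_bigr => j jS.
  rewrite (IHk (fun x => A (fcons (y j) x))); last first.
    move=> x i u v.
    have liftE w : fcons (y j) [eta x with i |-> w] =
        ([eta fcons (y j) x with lift ord0 i |-> w] : 'I_k.+1 -> T).
      apply/funext => i' /=; rewrite /fcons.
      case: (unliftP ord0 i') => [i'' ->|->] //=.
    by rewrite !liftE addA.
  over.
rewrite pair_big_dep /=.
pose h (p : J * {ffun 'I_k -> J}) : {ffun 'I_k.+1 -> J} :=
  [ffun i => if unlift ord0 i is Some i' then p.2 i' else p.1].
pose h' (phi : {ffun 'I_k.+1 -> J}) : J * {ffun 'I_k -> J} :=
  (phi ord0, [ffun i => phi (lift ord0 i)]).
rewrite [RHS](reindex h) /=; last first.
  exists h' => [[j psi] _|phi _]; rewrite /h /h' /=.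
    congr (_, _); first by rewrite ffunE unlift_none.
    by apply/ffunP => i; rewrite !ffunE liftK.
  by apply/ffunP => i; rewrite ffunE; case: unliftP => [i' ->|->]; rewrite ?ffunE.
apply: eq_big => [[j psi]|[j psi] _] /=.
  apply/andP/forallP => [[jS /forallP psiS] i|hS].
    by rewrite ffunE; case: unliftP => [i' _|_] //=.
  split; first by have := hS ord0; rewrite ffunE unlift_none.
  by apply/forallP => i; have := hS (lift ord0 i); rewrite ffunE liftK.
congr A; apply/funext => i; rewrite /fcons /= ffunE.
by case: unliftP.
Qed.

(** After expansion, the signs attached to [phi] run over the sets [S] containing its image, so
    [sum_signs_supset] leaves only the surjective [phi]. *)
Lemma polarization_onto k (A : ('I_k -> T) -> K) (J : finType) (y : J -> T) :
    multiadditive A ->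
  \sum_(S : {set J}) (-1) ^+ #|~: S| * A (fun=> \big[op/idx]_(j in S) y j) =
  \sum_(phi : {ffun 'I_k -> J} | phi @: 'I_k == setT) A (y \o phi).
Proof.
move=> addA.
under eq_bigr do rewrite multiadditive_expansion // mulr_sumr.
rewrite (exchange_big_dep predT) //= [RHS]big_mkcond /=; apply: eq_bigr => phi _.
rewrite -mulr_suml.
under eq_bigl => S.
  have -> : [forall i, phi i \in S] = (phi @: 'I_k \subset S).
    apply/forallP/subsetP => [phiS _ /imsetP[i _ ->] //|phiS i].
    exact/phiS/imset_f.
  over.
rewrite sum_signs_supset; case: eqP; rewrite ?mul1r ?mul0r //.
Qed.

Lemma polarization k (A : ('I_k -> T) -> K) (y : 'I_k -> T) :
    multiadditive A ->
  \sum_(S : {set 'I_k}) (-1) ^+ #|~: S| * A (fun=> \big[op/idx]_(j in S) y j) =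
  \sum_(s : 'S_k) A (y \o s).
Proof.
move=> addA; rewrite polarization_onto //.
(* A surjective self-map of a finite set is injective, hence a permutation; the default of [insubd]
   is never reached. *)
rewrite (reindex_onto (fun s : 'S_k => val s) (insubd (perm_one 'I_k))) /=; last first.
  move=> phi /eqP phiT; apply: insubdK; apply/injectiveP => i j.
  have /imset_injP : #|phi @: 'I_k| == #|'I_k| by rewrite phiT cardsT.
  by apply.
apply: eq_big => [s|s _].
  rewrite valKd eqxx andbT; apply/eqP/setP => i; rewrite inE.
  by apply/imsetP; exists (s^-1%g i) => //; rewrite -{1}(permKV s i) -pvalE.
by congr A; apply/funext => i /=; rewrite -pvalE.
Qed.

Lemma polarization_vanish k (A : ('I_k -> T) -> K) (J : finType) (y : J -> T) :
    multiadditive A -> (k < #|J|)%N ->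
  \sum_(S : {set J}) (-1) ^+ #|~: S| * A (fun=> \big[op/idx]_(j in S) y j) = 0.
Proof.
move=> addA kJ; rewrite polarization_onto // big_pred0 // => phi.
apply/eqP => phiT; have := leq_imset_card phi 'I_k.
by rewrite phiT cardsT card_ord leqNgt kJ.
Qed.
End Polarization.

(** * Exponential polynomials *)

Section Spectral.
Variables (R : realType) (K : fieldType).
Notation C := R[i].
Notation G := (mulgroup K).
Let mulgC := @mulgroup_mulC K.

(** The list is reversed because [foldr] applies the operator of the last index first, while
    [killed] uses the head of its list first. *)
Lemma killed_foldr (I : Type) (r : seq I) (chi : I -> G -> C) (x : I -> G) f :
  killed (map chi (rev r)) f ->
  foldr (fun i h => shift (x i) h - chi i (x i) *: h) f r = 0.
Proof.
elim/last_ind: r f => [|r a IHr] f //; rewrite rev_rcons foldr_rcons /= => kf.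
by apply: IHr; apply: kf.
Qed.

(** Evaluating the vanishing product of operators at 1 and isolating the full set expresses [f] of
    the whole product through proper subsets [S]; each term separates the variables in [S] from the
    others. *)
Lemma spectral_decomposable (f : G -> C) : spectral f -> decomposable f.
Proof.
(* Two zero functions are prepended to ensure at least two variables; [f] remains killed by the
   longer list. *)
move=> [s0 [_ ks0]]; pose s : seq (G -> C) := [:: 0, 0 & s0].
have ks : killed s f by apply: killed_catr (mulgC) [:: 0; 0] _ _ ks0.
pose chi i := nth 0 (rev s) i.
exists (size s); split=> //.
pose I := 'I_(size s).
have chiE : map (fun i : I => chi i) (rev (enum I)) = s.
  rewrite map_rev (map_comp chi val) val_enum_ord -(size_rev s).
  by rewrite -/(mkseq _ _) mkseq_nth revK.
have fE (x : I -> G) : f (\prod_(i < size s) x i)%g =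
    \sum_(S : {set I} | S != setT)
      - ((\prod_(i in ~: S) - chi i (x i)) * f (\prod_(i in S) x i)%g).
  have := @killed_foldr I (enum I) (fun i => chi i) x f.
  rewrite chiE => /(_ ks)/(congr1 (fun h => h 1%g)).
  rewrite (foldr_shift_expansion x (fun i => chi i (x i)) f 1%g (enum_uniq I)).
  have -> : [set i in enum I] = setT.
    by apply/setP => i; rewrite !inE mem_enum.
  rewrite (bigD1 setT) ?subxx //= setDv big_set0 mul1r mulg1 => /eqP.
  rewrite addr_eq0 -sumrN => /eqP fE; rewrite -[LHS](_ : f (\prod_(i in setT) x i)%g = _).
    rewrite fE; apply: eq_big => S; first by rewrite subsetT.
    by rewrite setTD mulg1.
  by congr f; apply: eq_bigl => i; rewrite inE.
pose T (S : {set I}) (x : I -> G) :=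
  - ((\prod_(i in ~: S) - chi i (x i)) * f (\prod_(i in S) x i)%g).
pose J := [set S : {set I} | S != setT].
exists #|J|, (fun t => T (enum_val t)); split; last first.
  move=> x; rewrite fE; transitivity (\sum_(S in J) T S x).
    by apply: eq_bigl => S; rewrite inE.
  by rewrite big_enum_val.
move=> t; have := enum_valP t; rewrite inE; set S := enum_val t => ST.
pose a : I := ord0; exists 2; split=> //.
have prod_congr (A : {set I}) (x y : I -> G) : {in A, x =1 y} ->
    (\prod_(i in A) x i)%g = (\prod_(i in A) y i)%g.
  by move=> xy; apply: eq_bigr => i /xy.
have chi_congr (A : {set I}) (x y : I -> G) : {in A, x =1 y} ->
    \prod_(i in A) - chi i (x i) = \prod_(i in A) - chi i (y i).
  by move=> xy; apply: eq_bigr => i /xy ->.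
(* For empty [S] the factor [f 1] is a constant, so the two nonempty blocks are taken to be one
   variable and all the others. *)
have [S0|S0] := eqVneq S set0.
  exists (fun j => if j == ord0 then [set a] else ~: [set a]).
  exists (fun j x => if j == ord0 then - chi a (x a) else
    - (\prod_(i in ~: [set a]) - chi i (x i)) * f 1%g); split.
  - move=> j; case: ifP => _; first by apply/set0Pn; exists a; rewrite inE.
    by apply/set0Pn; exists ord_max; rewrite !inE.
  - move=> j j'; case: ifP => j0; case: ifP => j'0.
    + by rewrite (eqP j0) (eqP j'0) eqxx.
    + by rewrite -setI_eq0 setICr.
    + by rewrite -setI_eq0 setIC setICr.
    + by case: j j0 => [[|[]]] //= ? _; case: j' j'0 => [[|[]]].
  - move=> j x y; case: ifP => _ xy; first by rewrite xy ?inE.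
    by rewrite (chi_congr _ x y).
  move=> x; rewrite big_ord_recl big_ord1 /= /T S0 setC0 big_set0.
  rewrite (bigD1 a) ?inE //= -mulrA -mulrN -mulNr; congr (_ * (- _ * _)).
  by apply: eq_bigl => i; rewrite !inE.
exists (fun j => if j == ord0 then S else ~: S).
exists (fun j x => if j == ord0 then f (\prod_(i in S) x i)%g else
    - (\prod_(i in ~: S) - chi i (x i))); split.
- move=> j; case: ifP => _ //; rewrite -setCT.
  by rewrite (inj_eq (@setC_inj _)).
- move=> j j'; case: ifP => j0; case: ifP => j'0.
  + by rewrite (eqP j0) (eqP j'0) eqxx.
  + by rewrite -setI_eq0 setICr.
  + by rewrite -setI_eq0 setIC setICr.
  + by case: j j0 => [[|[]]] //= ? _; case: j' j'0 => [[|[]]].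
- move=> j x y; case: ifP => _ xy; first by rewrite (prod_congr _ x y).
  by rewrite (chi_congr _ x y).
by move=> x; rewrite big_ord_recl big_ord1 /= /T mulrC mulrN.
Qed.
End Spectral.

(** * Spectral functions as generalized exponential polynomials *)

Section ExponentialPolynomials.
Variables (R : realType) (K : fieldType).
Notation C := R[i].
Notation G := (mulgroup K).
Let mulgC := @mulgroup_mulC K.

(** The scalar 1 keeps the shape of one step of [kills] for the trivial character. *)
Definition difference (g : G) (f : G -> C) : G -> C := shift g f - (1 : C) *: f.

Lemma difference_linear g : linear (difference g).
Proof.
move=> a f h; rewrite /difference linearP /= scalerDr scalerA mulrC -scalerA.
by rewrite opprD addrACA -scalerBr.
Qed.
HB.instance Definition _ g :=
  GRing.isLinear.Build C (G -> C) (G -> C) _ (difference g)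
    (difference_linear g).

Definition differences (l : seq G) (f : G -> C) : G -> C := foldr difference f l.

Lemma differencesB l f h : differences l (f - h) = differences l f - differences l h.
Proof. by elim: l => //= g l ->; rewrite raddfB. Qed.

Lemma killed_unipotent d f :
  killed (nseq d (fun=> 1)) f <-> forall l, size l = d -> differences l f = 0.
Proof.
elim: d f => [|d IHd] f; first by split=> [-> []|/(_ [::] erefl)].
split=> [kf l|fl]; last first.
  move=> /= g; apply: (IHd _).2 => l sl; have := fl (rcons l g).
  by rewrite size_rcons sl /differences foldr_rcons; apply.
case/lastP: l => // l g; rewrite size_rcons => -[sl].
by rewrite /differences foldr_rcons; apply: (IHd _).1 => //; apply: kf.
Qed.

Lemma differences_expansion (I : finType) (x : I -> G) (r : seq I) f z :
  uniq r -> differences (map x r) f z =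
  \sum_(S : {set I} | S \subset [set i in r])
    (-1) ^+ #|[set i in r] :\: S| * f ((\prod_(i in S) x i) * z)%g.
Proof.
move=> ur; rewrite /differences foldr_map.
have := foldr_shift_expansion x (fun=> 1 : C) f z ur.
by rewrite /difference => ->; apply: eq_bigr => S _; rewrite prodr_const.
Qed.

Lemma differences_enum (I : finType) (x : I -> G) f z :
  differences (map x (enum I)) f z =
  \sum_(S : {set I}) (-1) ^+ #|~: S| * f ((\prod_(i in S) x i) * z)%g.
Proof.
rewrite differences_expansion ?enum_uniq //.
have -> : [set i in enum I] = setT by apply/setP => i; rewrite !inE mem_enum.
by apply: eq_big => S; rewrite ?subsetT ?setTD.
Qed.

Lemma differences_perm (I : finType) (x : I -> G) (r r' : seq I) f :
  uniq r -> perm_eq r r' -> differences (map x r) f = differences (map x r') f.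
Proof.
move=> ur rr'; apply/funext => z.
rewrite !differences_expansion // -?(perm_uniq rr') //.
have -> // : [set i in r'] = [set i in r].
by apply/setP => i; rewrite !inE (perm_mem rr').
Qed.

(** For a function of degree at most [k], the symmetric form whose diagonal is the homogeneous part
    of degree [k]; the factorial compensates the sum over permutations in [polarization]. *)
Definition polar (k : nat) (f : G -> C) (y : 'I_k -> G) : C :=
  k`!%:R^-1 * differences (map y (enum 'I_k)) f 1%g.

Lemma polar_symmetric k f : symmetric_multi (@polar k f).
Proof.
move=> s y.
have us : uniq (map s (enum 'I_k)).
  by rewrite map_inj_uniq ?enum_uniq //; apply: perm_inj.
have pr : perm_eq (map s (enum 'I_k)) (enum 'I_k).
  apply: uniq_perm; rewrite ?enum_uniq // => i; rewrite mem_enum.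
  apply/mapP; exists (s^-1%g i); last by rewrite permKV.
  by rewrite mem_enum.
by rewrite /polar map_comp (differences_perm _ _ us pr).
Qed.

(** The difference by [u * v] is the sum of those by [u] and by [v] and of their composite; the
    composite contributes a difference of order [d + 1], which vanishes. *)
Lemma polar_hom d f : killed (nseq d.+1 (fun=> 1)) f ->
  hom_in_each_variable (@polar d f).
Proof.
move=> /killed_unipotent kf x i u v; rewrite /polar -mulrDr; congr (_ * _).
pose r := rem i (enum 'I_d); pose h := differences (map x r) f.
have E w : differences (map [eta x with i |-> w] (enum 'I_d)) f 1%g =
    difference w h 1%g.
  have pr : perm_eq (enum 'I_d) (i :: r) by rewrite perm_to_rem ?mem_enum.
  rewrite (differences_perm _ _ (enum_uniq _) pr) /= eqxx.
  rewrite /h; congr (difference w (differences _ f) 1%g).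
  apply/eq_in_map => j /=.
  by rewrite mem_rem_uniq ?enum_uniq // inE => /andP[/negbTE->].
have sz : size (u :: v :: map x r) = d.+1.
  have d0 : (0 < d)%N by case: d i {kf x r h E} => [[]|].
  by rewrite /= size_map size_rem ?mem_enum // size_enum_ord prednK.
have /(congr1 (fun h => h 1%g)) := kf _ sz.
rewrite !E -[differences _ _]/(difference u (difference v h)).
rewrite /difference /shift !fctE !scale1r !mulg1 [(v * u)%g]mulgC => uv.
by rewrite -(subr0_eq uv) [RHS]addrC addrA subrK.
Qed.

Definition polynomial_below (d : nat) (f : G -> C) : Prop :=
  exists A : forall k : nat, ('I_k -> G) -> C,
    (forall k, symmetric_multi (A k) /\ hom_in_each_variable (A k)) /\
    (forall x, f x = \sum_(k < d) A k (fun=> x)).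

(** Subtracting the diagonal [b] of the polar form removes the top degree part, and the induction
    hypothesis applies to the remainder [q]. *)
Lemma killed_polynomial_below d f :
  killed (nseq d (fun=> 1)) f -> polynomial_below d f.
Proof.
elim: d f => [|d IHd] f kf.
  exists (fun _ _ => 0); split=> [k|x]; last by rewrite kf big_ord0.
  by split=> // x i u v; rewrite addr0.
pose B := @polar d f; pose b x := B (fun=> x); pose q := f - b.
have homB : hom_in_each_variable B by apply: polar_hom.
have madB : @multiadditive _ _ (mulg : Monoid.com_law (1%g : G)) _ d B := homB.
have [|A [Ahom AE]] := IHd q.
  apply/killed_unipotent => l sl.
  have q1' (y : 'I_d -> G) : differences (map y (enum 'I_d)) q 1%g = 0.
    rewrite differencesB; apply/eqP; rewrite subr_eq0; apply/eqP.
    rewrite [RHS]differences_enum.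
    under eq_bigr do rewrite mulg1.
    rewrite (polarization y madB).
    rewrite (eq_bigr (fun=> B y)) => [|s _]; last exact: polar_symmetric.
    rewrite sumr_const card_Sn -mulr_natl /B /polar mulrA mulfV ?mul1r //.
    by rewrite Num.Theory.pnatr_eq0 -lt0n fact_gt0.
  have q1 l' : size l' = d -> differences l' q 1%g = 0.
    move/eqP=> sl'; have := q1' (tnth (Tuple sl')).
    by rewrite (map_tnth_enum (Tuple sl')).
  have q2 l' : size l' = d.+1 -> differences l' q 1%g = 0.
    move=> sl'; rewrite differencesB ((killed_unipotent _ _).1 kf) //.
    have lt_d : (d < #|'I_(size l')|)%N by rewrite card_ord sl'.
    have van := polarization_vanish (tnth (in_tuple l')) madB lt_d.
    apply/eqP; rewrite sub0r oppr_eq0 -[X in differences X](map_tnth_enum (in_tuple l')).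
    rewrite differences_enum; under eq_bigr do rewrite mulg1.
    by rewrite van.
  (* The values of a difference of order [d] at [z] and at 1 differ by one of order [d + 1], so [q1]
     and [q2] suffice. *)
  apply/funext => z; have := q2 (z :: l); rewrite /= sl => /(_ erefl).
  by rewrite /difference /shift !fctE q1 // mulg1 scaler0 subr0.
exists (fun k => if k == d then @polar k f else A k); split=> [k|x].
  case: eqP => [->|_] //; split=> //; exact: polar_symmetric.
rewrite big_ord_recr /= eqxx -/B -/(b x) -[LHS](subrK (b x)); congr (_ + _).
rewrite -[_ - _]/(q x) AE; apply: eq_bigr => k _.
by rewrite ltn_eqF.
Qed.

Lemma gep_add (f h : G -> C) : generalized_exponential_polynomial f ->
  generalized_exponential_polynomial h ->
  generalized_exponential_polynomial (f + h).
Proof.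
move=> [l1 [c1 [p1 [m1 [P1 M1 E1]]]]] [l2 [c2 [p2 [m2 [P2 M2 E2]]]]].
pose glue T (u : 'I_l1 -> T) (v : 'I_l2 -> T) (j : 'I_(l1 + l2)) : T :=
  match fintype.split j with inl a => u a | inr b => v b end.
exists (l1 + l2)%N, (glue _ c1 c2), (glue _ p1 p2), (glue _ m1 m2).
split=> [j|j|x]; rewrite /glue.
- by case: (fintype.split j).
- by case: (fintype.split j).
rewrite big_split_ord fctE E1 E2; congr (_ + _); apply: eq_bigr => j _.
  by rewrite (unsplitK (inl j)).
by rewrite (unsplitK (inr j)).
Qed.

Lemma gep_scale a (f : G -> C) : generalized_exponential_polynomial f ->
  generalized_exponential_polynomial (a *: f).
Proof.
move=> [l [c [p [m [P M E]]]]]; exists l, (fun j => a * c j), p, m.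
split=> // x; rewrite -[LHS]/(a * f x) E mulr_sumr.
by apply: eq_bigr => j _; rewrite -[RHS]mulrA.
Qed.

Lemma killed_generalized_polynomial d (f : G -> C) :
  killed (nseq d (fun=> 1)) f -> generalized_polynomial f.
Proof.
(* The witness [d] allows [d + 1] homogeneous terms, so one more trivial character is added to the
   list. *)
move=> kf; exists d; apply: killed_polynomial_below.
by apply: (@killed_catr _ _ mulgC [:: _]).
Qed.

(** Division by [chi] turns the operator for [chi] into the one for the trivial character, up to the
    nonzero factor [chi g]. *)
Lemma killed_primary d (chi f : G -> C) : character chi ->
  killed (nseq d chi) f -> generalized_exponential_polynomial f.
Proof.
move=> [chi1 chiM] kf.
have chi0 x : chi x != 0.
  apply/eqP => x0; have := chiM x x^-1%g.
  by rewrite mulgV chi1 x0 mul0r; apply/eqP/oner_neq0.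
pose p x := f x / chi x.
exists 1%N, (fun=> 1), (fun=> p), (fun=> chi); split=> // [_|x]; last first.
  by rewrite big_ord1 mul1r divfK.
apply: (@killed_generalized_polynomial d); rewrite {}/p.
elim: d f kf => [|d IHd] f /= kf.
  by rewrite kf; apply/funext => x; rewrite /= mul0r.
move=> g; have := subspaceZ (killed_subspace _) (chi g)^-1 (IHd _ (kf g)).
congr (killed _ _); apply/funext => x.
rewrite -[LHS]/((chi g)^-1 * ((f (g * x)%g - chi g * f x) / chi x)).
rewrite -[RHS]/(f (g * x)%g / chi (g * x)%g - 1 * (f x / chi x)).
rewrite chiM mulrBl mulrBr mul1r !mulrA mulVf // mul1r; congr (_ - _).
by rewrite invfM [(chi g)^-1 * f _]mulrC -!mulrA.
Qed.

Lemma killed_swap (a b : seq (G -> C)) (psi f : G -> C) (g : G) : killed (a ++ psi :: b) f ->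
  killed (a ++ b) (shift g f - psi g *: f).
Proof.
elim: a f => [|chi a IHa] f /= kf; first exact: kf.
move=> h; have := IHa _ (kf h).
congr (killed _ _); apply/funext => x.
rewrite -[LHS]/(f (h * (g * x))%g - chi h * f (g * x)%g -
  psi g * (f (h * x)%g - chi h * f x)).
rewrite -[RHS]/(f (g * (h * x))%g - psi g * f (h * x)%g -
  chi h * (f (g * x)%g - psi g * f x)).
rewrite !mulgA [(h * g)%g]mulgC.
ring.
Qed.

Lemma neq_nseq (X : Type) (x : X) (s : seq X) : s <> nseq (size s) x ->
  exists a y b, s = a ++ y :: b /\ y <> x.
Proof.
elim: s => // y s IHs /= ns.
have [yx|yx] := pselect (y = x); last by exists [::], y, s.
rewrite {}yx in ns *.
have [|a [z [b [-> zx]]]] := IHs; last by exists (x :: a), z, b.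
by move=> sE; apply: ns; rewrite -sE.
Qed.

(** Induction on the length of the list. If [chi] and [psi] in it differ at [g], the operators
    [T_g - psi g] and [T_g - chi g] differ by a nonzero scalar, so [f] is a combination of two
    functions killed by shorter lists; a constant list is the primary case. *)
Lemma spectral_gep (f : G -> C) :
  spectral f -> generalized_exponential_polynomial f.
Proof.
move=> [s [s_char kf]]; have [n] := ubnP (size s).
elim: n s f s_char kf => // n IHn [|chi s] f /= s_char kf sn.
  by exists 0%N, (fun=> 0), (fun=> f), (fun=> f); split=> [[]//|[]//|x];
     rewrite big_ord0 kf.
have [sE|sN] := pselect (s = nseq (size s) chi).
  apply: (@killed_primary (size s).+1 chi); first by case: s_char.
  by rewrite /= -sE.
have [a [psi [b [sE psichi]]]] := neq_nseq sN.
have [g psig] : exists g, psi g <> chi g.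
  apply/existsNP => psiE; apply: psichi; exact/funext.
have D0 : chi g - psi g != 0.
  by rewrite subr_eq0; apply/eqP => chiE; apply: psig.
have fE : f = (chi g - psi g)^-1 *:
    ((shift g f - psi g *: f) + (-1) *: (shift g f - chi g *: f)).
  rewrite scaleN1r opprB [X in _ *: X]addrC addrA subrK -scalerBl scalerA mulVf //.
  by rewrite scale1r.
rewrite fE; apply/gep_scale/gep_add; last apply: gep_scale.
  apply: (IHn (chi :: a ++ b)).
  - by move: s_char; rewrite /= sE !characters_cat /=; tauto.
  - by apply: (@killed_swap (chi :: a)); rewrite /= -sE.
  - by move: sn; rewrite sE /= !size_cat /= !addnS !ltnS.
by apply: (IHn s) => //; [case: s_char | apply: kf].
Qed.
End ExponentialPolynomials.

(** * Comparing terms of the polarized equation *)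

Section Restriction.
Variables (R : rcfType) (K : fieldType).
Notation C := R[i].
Notation G := (mulgroup K).
Variables (I J : finType) (w : I -> C) (E : I -> {set J}) (f u : I -> G -> C).

Hypothesis sum0 : forall x : J -> G,
  \sum_t w t * (f t (\prod_(j in E t) x j)%g * \prod_(j | j \notin E t) u t (x j))
  = 0.

Let upd (x : J -> G) (a : J) (v : G) : J -> G := fun j => if j == a then v else x j.

Let upd_prod (V : Type) (idx : V) (op : Monoid.com_law idx) (P : pred J)
    (F : G -> V) x a v : ~~ P a ->
  \big[op/idx]_(j | P j) F (upd x a v j) = \big[op/idx]_(j | P j) F (x j).
Proof.
move=> Pa; apply: eq_bigr => j Pj; rewrite /upd; case: eqP => // ja.
by rewrite -ja Pj in Pa.
Qed.

Let upd_prod1 (V : Type) (idx : V) (op : Monoid.com_law idx) (P : pred J)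
    (F : G -> V) x a v : P a ->
  \big[op/idx]_(j | P j) F (upd x a v j) =
  op (F v) (\big[op/idx]_(j | P j && (j != a)) F (x j)).
Proof.
move=> Pa; rewrite (bigD1 a) //= {1}/upd eqxx upd_prod //.
by rewrite eqxx andbF.
Qed.

(** For each [a] in [r], the identity at [x a = y a] is combined with those at [x a = e l]. This
    cancels every term in which [x a] is an argument of [u t], and applies a deviation to [f t] in
    the others. *)
Lemma deviation_extraction d (e : 'I_d -> G) (c : 'I_d -> G -> C)
    (r : seq J) (x y : J -> G) :
    (forall t v, u t v = \sum_l c l v * u t (e l)) -> uniq r ->
  \sum_(t | all (mem (E t)) r) w t *
    (foldr (fun j h => deviation e c (y j) h) (f t) r
       (\prod_(j | (j \in E t) && (j \notin r)) x j)%g *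
     \prod_(j | j \notin E t) u t (x j)) = 0.
Proof.
move=> uE; elim: r x => [|a r IHr] x /=.
  move=> _; rewrite -[RHS](sum0 x); apply: eq_bigr => t _; congr (_ * (f t _ * _)).
  by apply: eq_bigl => j; rewrite andbT.
case/andP=> ar ur; pose term t v := w t *
    (foldr (fun j h => deviation e c (y j) h) (f t) r
       (\prod_(j | (j \in E t) && (j \notin r)) upd x a v j)%g *
     \prod_(j | j \notin E t) u t (upd x a v j)).
have term0 v : \sum_(t | all (mem (E t)) r) term t v = 0 by apply: IHr.
transitivity (\sum_(t | all (mem (E t)) r)
    (term t (y a) - \sum_l c l (y a) * term t (e l))); last first.
  rewrite sumrB term0 exchange_big big1 ?subr0 // => l _.
  by rewrite -mulr_sumr term0 mulr0.
rewrite [RHS](bigID (fun t => a \in E t)) /=.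
rewrite [X in _ + X]big1 ?addr0 => [|t /andP[_ aE]]; last first.
  have naP : ~~ ((a \in E t) && (a \notin r)) by rewrite (negbTE aE).
  pose h := foldr (fun j h => deviation e c (y j) h) (f t) r
    (\prod_(j | (j \in E t) && (j \notin r)) x j)%g.
  pose U := \prod_(j | (j \notin E t) && (j != a)) u t (x j).
  have termE v : term t v = u t v * (w t * (h * U)).
    rewrite /term (upd_prod mulg id x _ naP) (upd_prod1 _ (u t) x _ aE) /=.
    by rewrite -/h -/U; ring.
  rewrite termE; under eq_bigr do rewrite termE mulrA.
  by rewrite -mulr_suml -uE subrr.
apply: eq_big => [t|t /andP[aE _]]; first by rewrite andbC.
have aP : (a \in E t) && (a \notin r) by rewrite aE.
have naP : ~~ (a \notin E t) by rewrite aE.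
pose h := foldr (fun j h => deviation e c (y j) h) (f t) r.
pose U := \prod_(j | j \notin E t) u t (x j).
pose Q := (\prod_(j | (j \in E t) && (j \notin a :: r)) x j)%g.
have termE v : term t v = h (v * Q)%g * (w t * U).
  rewrite /term (upd_prod1 mulg id x _ aP) (upd_prod _ (u t) x _ naP) mulrCA.
  congr (h (v * _)%g * _); apply: eq_bigl => j.
  by rewrite inE negb_or; case: (j \in E t); case: (j \in r); case: (j == a).
rewrite termE -/U -/Q -/h deviationE mulrCA mulrBl mulr_suml; congr (_ - _).
by apply: eq_bigr => l _; rewrite termE mulrA.
Qed.

(* Coefficient of the product of the h (x j), j in r, modulo V. *)
Lemma coefficient_extraction (V : (G -> C) -> Prop) (h : G -> C)
    (b : I -> J -> C) (r : seq J) (x : J -> G) :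
    subspace V -> ~ V h ->
    (forall t j, w t != 0 -> j \notin E t -> V (u t - b t j *: h)) ->
    (forall t j, w t != 0 -> j \in E t ->
      (E t = [set j] /\ V (f t - b t j *: h)) \/
      (b t j = 0 /\ forall z, V (shift z (f t)))) ->
    uniq r ->
  \sum_t w t * (\prod_(j <- r) b t j) *
    ((if has (mem (E t)) r then 1 else f t (\prod_(j in E t) x j)%g) *
     \prod_(j | (j \notin E t) && (j \notin r)) u t (x j)) = 0.
Proof.
move=> subV nVh uV fV; elim: r x => [|a r IHr] x /=.
  move=> _; rewrite -[RHS](sum0 x); apply: eq_bigr => t _.
  rewrite big_nil mulr1; congr (_ * (_ * _)).
  by apply: eq_bigl => j; rewrite andbT.
case/andP=> ar ur; pose term t v := w t * (\prod_(j <- r) b t j) *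
    ((if has (mem (E t)) r then 1 else f t (\prod_(j in E t) upd x a v j)%g) *
     \prod_(j | (j \notin E t) && (j \notin r)) u t (upd x a v j)).
have term0 : \sum_t term t = 0.
  by apply/funext => v; rewrite sum_fctE; apply: IHr.
(* As a function of [x a], the vanishing sum is congruent to [S *: h] modulo [V], and [h] is not in
   [V]. *)
set S := (X in X = 0); suff VS : V (0 *: h - S *: h).
  by rewrite -(subspace_subZ subV VS nVh).
rewrite scale0r -term0 /S scaler_suml -sumrB; apply: subspace_sum => // t _.
have [wt|wt] := eqVneq (w t) 0.
  rewrite (_ : term t = 0) ?sub0r ?wt ?mul0r ?scale0r ?oppr0.
    exact: subspace0.
  by apply/funext => v; rewrite /term wt !mul0r.
pose B := \prod_(j <- r) b t j.
pose U := \prod_(j | (j \notin E t) && (j \notin a :: r)) u t (x j).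
have [aE|aE] := boolP (a \in E t); last first.
  have aP : (a \notin E t) && (a \notin r) by rewrite aE.
  pose F := if has (mem (E t)) r then 1 else f t (\prod_(j in E t) x j)%g.
  have -> : term t = (w t * B * F * U) *: u t.
    apply/funext => v; rewrite /term (upd_prod mulg id x _ aE) -/F.
    rewrite (upd_prod1 _ (u t) x _ aP) -[RHS]/((w t * B * F * U) * u t v) /=.
    have -> : \prod_(j | (j \notin E t) && (j \notin r) && (j != a)) u t (x j) = U.
      apply: eq_bigl => j; rewrite inE negb_or.
      by case: (j \in E t); case: (j \in r); case: (j == a).
    by rewrite -/B; ring.
  have -> : w t * (\prod_(j <- a :: r) b t j) *
      ((if false || has (mem (E t)) r then 1 else f t (\prod_(j in E t) x j)%g) * U)
      = (w t * B * F * U) * b t a by rewrite big_cons -/B -/F; ring.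
  by rewrite -[(_ * b t a) *: h]scalerA -scalerBr; apply: subspaceZ => //; apply: uV.
have [hr|hr] := boolP (has (mem (E t)) r).
  (* Here [E t] contains [a] and some [j] in [r], hence is no singleton, so the coefficient at [j]
     is 0. *)
  have B0 : B = 0.
    have /hasP[j jr jE] := hr; apply/eqP; rewrite /B prodf_seq_eq0.
    apply/hasP; exists j => //=; case: (fV _ _ wt jE) => [[Et _]|[-> _]] //.
    by move: aE ar; rewrite Et inE => /eqP->; rewrite jr.
  rewrite (_ : term t = 0) ?big_cons -/B ?B0 ?mulr0 ?mul0r ?scale0r ?subr0.
    exact: subspace0.
  by apply/funext => v; rewrite /term -/B B0 mulr0 mul0r.
have naP : ~~ ((a \notin E t) && (a \notin r)) by rewrite aE.
have UE v : \prod_(j | (j \notin E t) && (j \notin r)) u t (upd x a v j) = U.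
  rewrite (upd_prod _ (u t) x _ naP); apply: eq_bigl => j; rewrite inE negb_or.
  by case: eqP => //= ->; rewrite aE.
rewrite big_cons -/B mul1r.
case: (fV _ _ wt aE) => [[Et Vf]|[b0 Vf]].
  have -> : term t = (w t * B * U) *: f t.
    apply/funext => v; rewrite /term (negbTE hr) UE -/B Et big_set1 /upd eqxx.
    by rewrite -[RHS]/((w t * B * U) * f t v); ring.
  have -> : w t * (b t a * B) * U = (w t * B * U) * b t a by ring.
  by rewrite -[(_ * b t a) *: h]scalerA -scalerBr; apply: subspaceZ.
pose z := (\prod_(j | (j \in E t) && (j != a)) x j)%g.
have -> : term t = (w t * B * U) *: shift z (f t).
  apply/funext => v; rewrite /term (negbTE hr) UE -/B (upd_prod1 mulg id x _ aE).
  rewrite -[RHS]/((w t * B * U) * f t (z * v)%g) -/z mulgroup_mulC /=; ring.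
by rewrite b0 mul0r mulr0 mul0r scale0r subr0; apply: subspaceZ.
Qed.
End Restriction.

(** The [u i] are adjoined one by one as long as [h] stays outside. If adjoining [u i] would capture
    [h], then [h] is a nonzero multiple of [u i] modulo the subspace, and conversely. *)
Lemma subspace_enlarge (C : fieldType) (E : lmodType C) (n : nat)
    (V : E -> Prop) (h : E) (u : 'I_n -> E) : subspace V -> ~ V h ->
  exists V' : E -> Prop, [/\ subspace V', forall x, V x -> V' x, ~ V' h &
    forall i, exists b, V' (u i - b *: h)].
Proof.
move=> subV nVh; elim: n u => [|n IHn] u; first by exists V; split=> // -[].
have [V1 [subV1 VV1 nV1h V1u]] := IHn (u \o lift ord0).
have [[c V1c]|nc] := pselect (exists c, V1 (h - c *: u ord0)).
  exists V1; split=> // i; case: (unliftP ord0 i) => [j ->|->]; first exact: V1u.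
  have c0 : c != 0.
    by apply/eqP => c0; apply: nV1h; move: V1c; rewrite c0 scale0r subr0.
  exists c^-1; have := subspaceZ subV1 (- c^-1) V1c.
  by rewrite scalerBr scalerA mulNr mulVf // scaleN1r opprK scaleNr addrC.
exists (fun z => exists b, V1 (z - b *: u ord0)).
have V1V' z : V1 z -> exists b, V1 (z - b *: u ord0).
  by exists 0; rewrite scale0r subr0.
split=> // [|x Vx|i]; first exact: add_line_subspace.
  exact/V1V'/VV1.
case: (unliftP ord0 i) => [j ->|->].
  by have [b Vb] := V1u j; exists b; apply: V1V'.
by exists 0, 1; rewrite scale0r subr0 scale1r subrr; apply: subspace0.
Qed.

Section FoldDeviation.
Variables (R : rcfType) (K : fieldType).
Notation C := R[i].
Notation G := (mulgroup K).
Variables (d : nat) (e : 'I_d -> G) (c : 'I_d -> G -> C) (J : eqType).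
Implicit Types (r : seq J) (y : J -> G).

Let devs y r (h : G -> C) := foldr (fun j k => deviation e c (y j) k) h r.

Lemma foldr_deviation_sum y r (I : finType) (P : pred I) (k : I -> C)
    (F : I -> G -> C) :
  devs y r (\sum_(t | P t) k t *: F t) = \sum_(t | P t) k t *: devs y r (F t).
Proof.
elim: r => //= a r ->; rewrite raddf_sum; apply: eq_bigr => t _.
by rewrite /= linearZ.
Qed.

Lemma foldr_deviation_shift y r z (h : G -> C) :
  devs y r (shift z h) = shift z (devs y r h).
Proof.
elim: r => //= a r ->; apply/funext => x.
rewrite -[RHS]/(deviation e c (y a) (devs y r h) (z * x)%g) !deviationE.
have shiftE v : shift z (devs y r h) (v * x)%g = devs y r h (v * (z * x))%g.
  by rewrite /shift !mulgA [(z * v)%g]mulgroup_mulC.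
by rewrite shiftE; under eq_bigr do rewrite shiftE.
Qed.

Lemma foldr_deviations r (h : G -> C) : uniq r ->
  (forall y, devs y r h 1%g = 0) -> deviations e c (size r) h.
Proof.
elim/last_ind: r h => [|r a IHr] h; first by move=> _ /(_ (fun=> 1%g)).
rewrite rcons_uniq size_rcons => /andP[ar ur] h0 v; apply: IHr => // y.
have := h0 (fun j => if j == a then v else y j).
rewrite /devs foldr_rcons eqxx => <-; congr (_ 1%g).
elim: r ar {ur h0} => //= b r IHr; rewrite inE negb_or => /andP[ab ar].
by rewrite eq_sym (negbTE ab) IHr.
Qed.
End FoldDeviation.

(** * Solutions of the polarized equation are spectral *)

Section Solutions.
Variables (R : realType) (K : fieldType).
Notation C := R[i].
Notation G := (mulgroup K).
Variables (n N : nat) (p : 'I_n -> nat) (f g : 'I_n -> G -> C).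
Variable w : 'I_n * {set 'I_N} -> nat.

Let ini i := [set j : 'I_N | (j < p i)%N].

Hypothesis p_gt0 : forall i, (0 < p i)%N.
Hypothesis p_ltN : forall i, (p i < N)%N.
Hypothesis p_mono : forall i j : 'I_n, (i < j)%N -> (p i < p j)%N.
Hypothesis p_neq : forall i j : 'I_n, i != j -> p i != (N - p j)%N.
Hypothesis f_neq0 : forall i, exists x, f i x != 0.
Hypothesis g_neq0 : forall i, exists x, g i x != 0.
Hypothesis w_card : forall t, w t != 0%N -> #|t.2| = p t.1.
Hypothesis w_ini : forall i, w (i, ini i) != 0%N.
Hypothesis sum0 : forall x : 'I_N -> G,
  \sum_t (w t)%:R * (f t.1 (\prod_(j in t.2) x j)%g *
    \prod_(j | j \notin t.2) g t.1 (x j)) = 0.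

Let card_ini i : #|ini i| = p i.
Proof.
by rewrite -(w_card (w_ini i)).
Qed.

Let p_le i j : (p i <= p j)%N -> (i <= j)%N.
Proof.
by move=> pij; rewrite leqNgt; apply/negP => /p_mono; rewrite ltnNge pij.
Qed.

(** Cardinalities give [p i <= p t.1], hence [i <= t.1]; equality of the indices would force
    equality of the sets. *)
Let ini_sub i t : w t != 0%N -> ini i \subset t.2 -> t != (i, ini i) ->
  (i < t.1)%N.
Proof.
case: t => k S wt iS; have kS := w_card wt; have := subset_leq_card iS.
rewrite card_ini kS => /p_le ik tn; rewrite ltn_neqAle ik andbT /=.
apply: contra tn => /eqP/val_inj ki; rewrite -ki xpair_eqE eqxx /= eq_sym.
by rewrite eqEcard iS kS card_ini ki leqnn.
Qed.

Let sub_ini i t : w t != 0%N -> t.2 \subset ini i -> t != (i, ini i) ->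
  (t.1 < i)%N.
Proof.
case: t => k S wt Si; have kS := w_card wt; have := subset_leq_card Si.
rewrite card_ini kS => /p_le ki tn; rewrite ltn_neqAle ki andbT /=.
apply: contra tn => /eqP/val_inj ik; rewrite ik xpair_eqE eqxx /=.
by rewrite eqEcard Si kS card_ini ik leqnn.
Qed.

Let natC_eq0 k : ((k%:R : C) == 0) = (k == 0%N).
Proof. exact: Num.Theory.pnatr_eq0. Qed.

Lemma f_spectral i : (2 <= p i)%N -> spectral (f i).
Proof.
have [d [e [_ eP]]] := finite_spanning (fun=> True) (fun v => \row_i g i v).
have [c cP] := choice (fun v => eP v I).
have gE t v : g t v = \sum_l c v l * g t (e l).
  have := congr1 (fun A : 'rV_n => A 0 t) (cP v); rewrite mxE summxE => ->.
  by apply: eq_bigr => l _; rewrite !mxE.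
pose c' l v := c v l.
(* Downward induction on [i]: the terms whose set properly contains [ini i] have a larger index. *)
have [m] := ubnP (n - i); elim: m i => // m IHm i nim pi2.
have [y0 gy0] := g_neq0 i.
(* A constant choice with [g i y0] nonzero makes the coefficient of [f i] in [h] nonzero. *)
pose x (j : 'I_N) := y0; pose r := enum (ini i).
pose Q (t : 'I_n * {set 'I_N}) := all (mem t.2) r.
pose k (t : 'I_n * {set 'I_N}) := (w t)%:R * \prod_(j | j \notin t.2) g t.1 (x j) : C.
pose z (t : 'I_n * {set 'I_N}) := (\prod_(j | (j \in t.2) && (j \notin r)) x j)%g.
pose h := \sum_(t | Q t) k t *: shift (z t) (f t.1).
have QE t : Q t = (ini i \subset t.2).
  apply/allP/subsetP => tP j ji; apply: tP; first by rewrite mem_enum.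
  by rewrite mem_enum in ji.
have dev_h : deviations e c' (p i) h.
  rewrite -card_ini cardE; apply: foldr_deviations (enum_uniq _) _ => y.
  rewrite foldr_deviation_sum sum_fctE.
  have ext := @deviation_extraction R K _ _ (fun t => (w t)%:R) snd
    (fun t => f t.1) (fun t => g t.1) sum0 d e c' r x y (fun t => gE t.1)
    (enum_uniq _).
  rewrite -[RHS]ext; apply: eq_bigr => t _; rewrite foldr_deviation_shift.
  rewrite -[LHS]/(k t * foldr _ (f t.1) r (z t * 1)%g) mulg1 /k -/(z t).
  by rewrite -mulrA; congr (_ * _); rewrite mulrC.
have h_spectral : spectral h.
  have [s [s_char sP]] := deviations_killed (@mulgroup_mulC K) e c' (p i).-2.
  exists s; split=> //; apply: sP.
  by move: dev_h; case: (p i) pi2 => [|[]].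
pose t0 := (i, ini i); have subS := spectral_subspace R (@mulgroup_mulC K).
have hE : h = k t0 *: f i + \sum_(t | Q t && (t != t0)) k t *: shift (z t) (f t.1).
  rewrite /h (bigD1 t0) ?QE //=; congr (_ *: _ + _).
  rewrite /z big_pred0 ?shift1 // => j /=.
  by rewrite mem_enum andbN.
have rest : spectral (\sum_(t | Q t && (t != t0)) k t *: shift (z t) (f t.1)).
  apply: subspace_sum => // t /andP[Qt tn]; rewrite QE in Qt.
  have [wt|wt] := eqVneq (w t) 0%N.
    by rewrite /k wt mul0r scale0r; apply: subspace0.
  have it := ini_sub wt Qt tn.
  apply: subspaceZ => //; apply: spectral_stable; first exact: mulgroup_mulC.
  apply: IHm; last exact: leq_trans pi2 (ltnW (p_mono it)).
  by rewrite -ltnS (leq_trans _ nim) // ltnS ltn_sub2l.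
have k0 : k t0 != 0.
  rewrite mulf_neq0 ?natC_eq0 ?w_ini //.
  by apply/prodf_neq0 => j _.
have -> : f i = (k t0)^-1 *: (h - \sum_(t | Q t && (t != t0)) k t *: shift (z t) (f t.1)).
  by rewrite hE addrK scalerA mulVf // scale1r.
by apply: subspaceZ => //; apply: subspaceB.
Qed.

Section Coefficients.
Variables (V : (G -> C) -> Prop) (h : G -> C) (a b : 'I_n -> C).
Hypotheses (subV : subspace V) (nVh : ~ V h).
Hypothesis gV : forall i, V (g i - b i *: h).
Hypothesis fV : forall i,
  (p i = 1%N /\ V (f i - a i *: h)) \/ (a i = 0 /\ forall z, V (shift z (f i))).

(** The factor contributed by the variable [j] when the coefficient of a product of values of [h] is
    read off in the term [t]. *)
Let beta (t : 'I_n * {set 'I_N}) (j : 'I_N) := if j \in t.2 then a t.1 else b t.1.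

Let extraction (r : seq 'I_N) (x : 'I_N -> G) : uniq r ->
  \sum_t (w t)%:R * (\prod_(j <- r) beta t j) *
    ((if has (mem t.2) r then 1 else f t.1 (\prod_(j in t.2) x j)%g) *
     \prod_(j | (j \notin t.2) && (j \notin r)) g t.1 (x j)) = 0.
Proof.
apply: (@coefficient_extraction R K _ _ (fun t => (w t)%:R) snd
  (fun t => f t.1) (fun t => g t.1) sum0 V h beta r x subV nVh) => t j wt jt.
  by rewrite /beta (negbTE jt).
rewrite natC_eq0 in wt; rewrite /beta jt.
case: (fV t.1) => [[p1 Vf]|]; [left | by right].
split=> //; have /eqP := w_card wt; rewrite p1 => /cards1P[k tk].
by move: jt; rewrite tk inE => /eqP->.
Qed.

(** Extraction in the variables outside [ini i] leaves only the term of [(i, ini i)], a nonzero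
    multiple of a power of [b i] with exponent [N - p i]. *)
Lemma coefficient_eq0 i :
  (forall t, w t != 0%N -> t != (i, ini i) ->
    exists2 j, j \notin ini i & beta t j = 0) -> b i = 0.
Proof.
move=> tP; apply/eqP/negP => /negP bi.
have [z fz] := f_neq0 i; have N0 : (0 < N)%N by apply: leq_trans (p_ltN i).
(* The variable [o] belongs to [ini i], so the argument of [f i] becomes [z]. *)
pose o := Ordinal N0; pose x (j : 'I_N) := if j == o then z else 1%g.
pose r := enum (~: ini i).
have xE : (\prod_(j in ini i) x j)%g = z.
  rewrite (bigD1 o) ?inE //= {1}/x eqxx big1 ?mulg1 // => j /andP[_ /negbTE jo].
  by rewrite /x jo.
have /eqP := extraction x (enum_uniq (~: ini i)).
rewrite (bigD1 (i, ini i)) //= [X in _ + X]big1 ?addr0 => [|t tn]; last first.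
  have [->|wt] := eqVneq (w t) 0%N; first by rewrite !mul0r.
  have [j ji tj] := tP t wt tn.
  suff -> : \prod_(j <- r) beta t j = 0 by rewrite mulr0 mul0r.
  apply/eqP; rewrite prodf_seq_eq0; apply/hasP; exists j; last by rewrite /= tj.
  by rewrite mem_enum in_setC.
have /negbTE-> : ~~ has (mem (ini i)) r.
  by apply/hasPn => j; rewrite mem_enum in_setC.
rewrite xE [X in _ * (_ * X)]big_pred0 => [|j]; last first.
  by rewrite mem_enum in_setC negbK andNb.
apply/negP; rewrite mulr1 !mulf_neq0 ?natC_eq0 ?w_ini //.
rewrite prodf_seq_neq0; apply/allP => j; rewrite mem_enum in_setC => /negbTE ji.
by rewrite /= /beta /= ji.
Qed.

Let ex_out i (S : {set 'I_N}) : ~~ (S \subset ini i) ->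
  exists2 j, j \notin ini i & j \in S.
Proof. by case/subsetPn => j jS ji; exists j. Qed.

Let ex_notin i : exists j : 'I_N, j \notin ini i.
Proof. by exists (Ordinal (p_ltN i)); rewrite inE /= ltnn. Qed.

(** Induction on [i]. A competing term either has a variable of its set outside [ini i], where the
    factor is an [a], or has a smaller index, where the factor [b] is already known to vanish. *)
Lemma coefficients_eq0_regular : (forall i, a i = 0) -> forall i, b i = 0.
Proof.
move=> a0 i; have [m] := ubnP (val i); elim: m i => // m IHm i im.
apply: coefficient_eq0 => t wt tn.
have [ti|/ex_out[j ji jt]] := boolP (t.2 \subset ini i); last first.
  by exists j; rewrite // /beta jt.
have [j ji] := ex_notin i; exists j => //; rewrite /beta.
case: ifP => // _; apply: IHm; rewrite -ltnS (leq_trans _ im) // ltnS.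
exact: sub_ini.
Qed.

Variable i1 : 'I_n.
Hypotheses (p_i1 : p i1 = 1%N) (a_i1 : a i1 = 1).
Hypothesis a_neq : forall i, i != i1 -> a i = 0.

(** Extraction in all variables leaves only terms of index [i1], each equal to its weight times
    [b i1 ^+ N.-1]. The weights are natural numbers, not all zero, so they cannot cancel. *)
Let b_i1 : b i1 = 0.
Proof.
apply/eqP/negP => /negP b0.
have N0 : (0 < N)%N by apply: leq_trans (p_ltN i1).
pose x (j : 'I_N) := 1%g : G.
have /eqP := extraction x (enum_uniq 'I_N).
rewrite (eq_bigr (fun t => ((t.1 == i1) * w t)%:R * b i1 ^+ N.-1)) => [|t _].
  rewrite -mulr_suml mulf_eq0 expf_eq0 (negbTE b0) andbF orbF -natr_sum natC_eq0.
  rewrite sum_nat_eq0 => /forallP/(_ (i1, ini i1)).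
  by rewrite eqxx mul1n (negbTE (w_ini i1)).
have [->|wt] := eqVneq (w t) 0%N; first by rewrite muln0 !mul0r.
have [ti|ti] := eqVneq t.1 i1; last first.
  have /set0Pn[j jt] : t.2 != set0 by rewrite -card_gt0 w_card.
  suff -> : \prod_(j <- enum 'I_N) beta t j = 0 by rewrite mulr0 !mul0r.
  apply/eqP; rewrite prodf_seq_eq0; apply/hasP; exists j; rewrite ?mem_enum //=.
  by rewrite /beta jt a_neq.
have /eqP := w_card wt; rewrite ti p_i1 => /cards1P[k tk].
have -> : has (mem t.2) (enum 'I_N).
  by apply/hasP; exists k; rewrite ?mem_enum //= tk inE.
rewrite [X in _ * (_ * X)]big_pred0 => [|j]; last by rewrite mem_enum andbF.
rewrite mul1n !mulr1; congr (_ * _).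
rewrite big_enum /= (bigD1 k) //= {1}/beta tk inE eqxx ti a_i1 mul1r.
rewrite (eq_bigr (fun=> b i1)) => [|j /negbTE jk]; last first.
  by rewrite /beta tk inE jk ti.
rewrite prodr_const; congr (_ ^+ _); have := cardC1 k; rewrite card_ord => <-.
by apply: eq_card => j; rewrite !inE.
Qed.

Lemma coefficients_eq0_singular i : b i = 0.
Proof.
have [m] := ubnP (val i); elim: m i => // m IHm i im.
have [->|ii1] := eqVneq i i1; first exact: b_i1.
apply: coefficient_eq0 => t wt tn.
have [ti1|ti1] := eqVneq t.1 i1; last first.
  have [ti|/ex_out[j ji jt]] := boolP (t.2 \subset ini i); last first.
    by exists j; rewrite // /beta jt a_neq.
  have [j ji] := ex_notin i; exists j => //; rewrite /beta a_neq //.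
  case: ifP => // _; apply: IHm; rewrite -ltnS (leq_trans _ im) // ltnS.
  exact: sub_ini.
have /eqP := w_card wt; rewrite ti1 p_i1 => /cards1P[k tk].
(* Since [N - p i] is positive and different from [p i1 = 1], at least two variables lie outside
   [ini i]; one of them avoids [k] and contributes [b i1 = 0]. *)
have : (1 < #|~: ini i|)%N.
  rewrite cardsCs setCK card_ord card_ini ltn_neqAle subn_gt0 p_ltN andbT.
  by rewrite -p_i1 p_neq // eq_sym.
rewrite (cardsD1 k) => lt1.
have /set0Pn[j] : ~: ini i :\ k != set0.
  by rewrite -card_gt0; case: (k \in _) lt1 => //; apply: ltnW.
rewrite !inE => /andP[jk ji]; exists j; first by rewrite inE.
by rewrite /beta tk inE (negbTE jk) ti1 b_i1.
Qed.

(** Extraction in the single variable of [ini i1] leaves one term, a nonzero weight times a power of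
    the nonzero value [g i1 y0]. *)
Lemma coefficients_singular_False : False.
Proof.
have [y0 gy0] := g_neq0 i1; pose x (j : 'I_N) := y0.
have /eqP := extraction x (enum_uniq (ini i1)).
rewrite (bigD1 (i1, ini i1)) //= [X in _ + X]big1 ?addr0 => [|t tn]; last first.
  have [->|wt] := eqVneq (w t) 0%N; first by rewrite !mul0r.
  suff [j ji tj] : exists2 j, j \in ini i1 & beta t j = 0.
    suff -> : \prod_(j <- enum (ini i1)) beta t j = 0 by rewrite mulr0 mul0r.
    apply/eqP; rewrite prodf_seq_eq0; apply/hasP; exists j; last by rewrite /= tj.
    by rewrite mem_enum.
  have [ti1|ti1] := eqVneq t.1 i1; last first.
    have /set0Pn[j ji] : ini i1 != set0 by rewrite -card_gt0 card_ini.
    by exists j => //; rewrite /beta a_neq // coefficients_eq0_singular if_same.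
  have [st|/subsetPn[j ji jt]] := boolP (ini i1 \subset t.2).
    by have := ini_sub wt st tn; rewrite ti1 ltnn.
  by exists j => //; rewrite /beta (negbTE jt) coefficients_eq0_singular.
apply/negP; rewrite !mulf_neq0 ?natC_eq0 ?w_ini //.
- rewrite prodf_seq_neq0; apply/allP => j; rewrite mem_enum => ji.
  by rewrite /= /beta /= ji a_i1 oner_neq0.
- have /set0Pn[j ji] : ini i1 != set0 by rewrite -card_gt0 card_ini.
  have -> : has (mem (ini i1)) (enum (ini i1)).
    by apply/hasP; exists j; rewrite ?mem_enum.
  exact: oner_neq0.
by apply/prodf_neq0 => j _.
Qed.
End Coefficients.

Lemma solutions_spectral i : spectral (f i) /\ spectral (g i).
Proof.
have subS := spectral_subspace R (@mulgroup_mulC K).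
have f_shift k : spectral (f k) -> forall z, spectral (shift z (f k)).
  by move=> fk z; apply: spectral_stable fk; apply: mulgroup_mulC.
(* A non-spectral [f i1] has [p i1 = 1]; all other exponents then exceed 1, so [h = f i1] is the
   singular case. *)
have all_f : forall k, spectral (f k).
  move=> i1; apply: contrapT => nf.
  have p1 : p i1 = 1%N.
    apply/eqP; rewrite eqn_leq p_gt0 andbT leqNgt; apply/negP => p2.
    exact/nf/f_spectral.
  have [V [subV SV nVf gV]] := subspace_enlarge g subS nf.
  have [b bP] := choice gV.
  apply: (@coefficients_singular_False V (f i1) (fun k => (k == i1)%:R) b _ _ _ _ i1)
    => //.
  - move=> k; have [->|ki] := eqVneq k i1.
      by left; rewrite scale1r subrr; split=> //; apply: subspace0.
    right; split=> // z; apply/SV/f_shift/f_spectral.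
    rewrite ltn_neqAle p_gt0 andbT -p1.
    apply/eqP => pk; case/negP: ki; apply/eqP/val_inj/eqP.
    by rewrite eqn_leq !p_le // pk.
  - by rewrite /= eqxx.
  by move=> k /negbTE /= ->.
(* With every [f k] spectral, [h = g i] is the regular case, and [b i = 0] would put [g i] into
   [V]. *)
split=> //; apply: contrapT => ng.
have [V [subV SV nVg gV]] := subspace_enlarge g subS ng.
have [b bP] := choice gV.
have b0 : b i = 0.
  apply: (@coefficients_eq0_regular V (g i) (fun=> 0) b) => // k.
  by right; split=> // z; apply/SV/f_shift.
by apply: nVg; have := bP i; rewrite b0 scale0r subr0.
Qed.
End Solutions.

(** * Polarization of the functional equation *)

Section Equation.
Variables (R : realType) (F : divringClosed R[i]) (n N : nat).
Notation C := R[i].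
Notation G := (mulgroup (subfield F)).
Variables (p q : 'I_n -> nat) (f g : 'I_n -> {additive subfield F -> C}).
Hypothesis hpq : forall i, (p i + q i)%N = N.
Hypothesis heq : forall x : subfield F,
  \sum_(i < n) f i (x ^+ p i) * (g i x) ^+ q i = 0.

Let ini i := [set j : 'I_N | (j < p i)%N].

(** A multiadditive function whose diagonal is the summand of index [i] in the equation. *)
Let term i (x : 'I_N -> subfield F) : C :=
  f i (\prod_(j in ini i) x j) * \prod_(j | j \notin ini i) g i (x j).

Let card_ini i : #|ini i| = p i.
Proof.
have pN : (p i <= N)%N by rewrite -(hpq i) leq_addr.
have widen_inj : injective (widen_ord pN).
  by move=> k l /(congr1 val) /= /val_inj.
rewrite -[RHS](card_ord (p i)) -(card_imset predT widen_inj).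
apply: eq_card => j; rewrite inE; apply/idP/imsetP => [ji|[k _ ->] /=].
  by exists (Ordinal ji) => //; apply/val_inj.
exact: ltn_ord.
Qed.

Let term_multiadditive i : @multiadditive _ _ +%R _ N (term i).
Proof.
move=> x j u v; rewrite /term.
have [ji|ji] := boolP (j \in ini i).
  have E z : \prod_(k | k \notin ini i) g i ([eta x with j |-> z] k) =
      \prod_(k | k \notin ini i) g i (x k).
    apply: eq_bigr => k ki /=; case: eqP => // kj; by rewrite kj ji in ki.
  have D z : \prod_(k in ini i) [eta x with j |-> z] k =
      z * \prod_(k in ini i | k != j) x k.
    rewrite (bigD1 j) //= eqxx; congr (_ * _).
    by apply: eq_bigr => k /andP[_ /negbTE->].
  by rewrite !E !D -mulrDl -raddfD -mulrDl.
have E z : \prod_(k in ini i) [eta x with j |-> z] k = \prod_(k in ini i) x k.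
  apply: eq_bigr => k ki /=; case: eqP => // kj; by rewrite -kj ki in ji.
have D z : \prod_(k | k \notin ini i) g i ([eta x with j |-> z] k) =
    g i z * \prod_(k | (k \notin ini i) && (k != j)) g i (x k).
  rewrite (bigD1 j) //= eqxx; congr (_ * _).
  by apply: eq_bigr => k /andP[_ /negbTE->].
by rewrite !E !D raddfD mulrDl mulrDr.
Qed.

(** The permutation sums become signed sums of diagonal values at partial sums of the [y j], where
    [heq] applies. *)
Let polarized (y : 'I_N -> subfield F) :
  \sum_(i < n) \sum_(s : 'S_N) term i (y \o s) = 0.
Proof.
under eq_bigr do rewrite -(polarization y (term_multiadditive _)).
rewrite exchange_big big1 // => S _ /=; rewrite -mulr_sumr.
rewrite [X in _ * X](_ : _ = 0) ?mulr0 // -[RHS](heq (\sum_(j in S) y j)).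
apply: eq_bigr => i _; rewrite /term !prodr_const card_ini; congr (_ * _ ^+ _).
apply: (@addnI (p i)); have := cardC (mem (ini i)).
by rewrite card_ord card_ini hpq.
Qed.

(** The number of permutations that produce the same term: the product of the factorials of [p t.1]
    and [q t.1] if [t.2] has [p t.1] elements, and 0 otherwise. *)
Definition weight (t : 'I_n * {set 'I_N}) : nat :=
  #|[set s : 'S_N | s @: ini t.1 == t.2]|.

Lemma weight_card t : weight t != 0%N -> #|t.2| = p t.1.
Proof.
rewrite -lt0n card_gt0 => /set0Pn[s]; rewrite inE => /eqP <-.
by rewrite card_imset ?card_ini //; apply: perm_inj.
Qed.

Lemma weight_ini i : weight (i, ini i) != 0%N.
Proof.
rewrite -lt0n card_gt0; apply/set0Pn; exists 1%g; rewrite inE /=.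
by rewrite (eq_imset _ (@perm1 _)) imset_id.
Qed.

Lemma polarized_equation (x : 'I_N -> G) :
  \sum_t (weight t)%:R * (restrict_mulgroup (f t.1) (\prod_(j in t.2) x j)%g *
    \prod_(j | j \notin t.2) restrict_mulgroup (g t.1) (x j)) = 0.
Proof.
pose y j := val (x j).
have fE i (S : {set 'I_N}) : restrict_mulgroup (f i) (\prod_(j in S) x j)%g =
    f i (\prod_(j in S) y j).
  by congr (f i _); apply: (big_morph val).
rewrite -[RHS](polarized y).
rewrite -(pair_big predT predT (fun i S => (weight (i, S))%:R *
  (restrict_mulgroup (f i) (\prod_(j in S) x j)%g *
    \prod_(j | j \notin S) restrict_mulgroup (g i) (x j)))) /=.
apply: eq_bigr => i _.
rewrite [RHS](partition_big (fun s : 'S_N => s @: ini i) predT) //=.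
apply: eq_bigr => S _; rewrite fE mulr_natl /weight -sumr_const.
apply: eq_big => [s|s]; rewrite inE //= => /eqP sS.
have memS j : (s j \in S) = (j \in ini i).
  by rewrite -sS mem_imset //; apply: perm_inj.
rewrite (reindex_inj (@perm_inj _ s)) /= (eq_bigl _ _ memS); congr (_ * _).
rewrite (reindex_inj (@perm_inj _ s)) /=.
by apply: eq_bigl => j; rewrite memS.
Qed.
End Equation.

Theorem theorem5 (R : realType) (F : divringClosed R[i]) (n N : nat)
    (hn : (0 < n)%N) (hN : (0 < N)%N)
    (p q : 'I_n -> nat)
    (hp0 : forall i, (0 < p i)%N) (hq0 : forall i, (0 < q i)%N)
    (hp : forall i j : 'I_n, (i < j)%N -> (p i < p j)%N)
    (hpq : forall i, (p i + q i)%N = N)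
    (hne : forall i j : 'I_n, i != j -> p i != q j)
    (f g : 'I_n -> {additive subfield F -> R[i]})
    (hf : forall i, exists x, f i x != 0)
    (hg : forall i, exists x, g i x != 0)
    (heq : forall x : subfield F,
        \sum_(i < n) f i (x ^+ p i) * (g i x) ^+ q i = 0) :
  forall i : 'I_n,
    [/\ decomposable (restrict_mulgroup (f i)),
        decomposable (restrict_mulgroup (g i)),
        generalized_exponential_polynomial (restrict_mulgroup (f i)) &
        generalized_exponential_polynomial (restrict_mulgroup (g i))].
Proof.
(* An additive function vanishes at 0, so a nonzero value is taken on the multiplicative group. *)
have neq0 (u : {additive subfield F -> R[i]}) : (exists x, u x != 0) ->
    exists x, restrict_mulgroup u x != 0.
  move=> [x ux]; have x0 : x != 0.
    by apply: contraNneq ux => ->; rewrite raddf0.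
  by exists (MulGroup x0).
move=> i.
have [|||||||||sf sg] := @solutions_spectral R (subfield F) n N p
  (fun i => restrict_mulgroup (f i)) (fun i => restrict_mulgroup (g i))
  (@weight n N p) _ _ _ _ _ _ _ _ _ i.
- exact: hp0.
- by move=> k; rewrite -(hpq k) -[X in (X < _)%N]addn0 ltn_add2l.
- exact: hp.
- by move=> k l kl; rewrite -(hpq l) addKn hne.
- by move=> k; apply: neq0.
- by move=> k; apply: neq0.
- exact: weight_card hpq.
- exact: weight_ini.
- exact: polarized_equation hpq heq.
split; by [apply: spectral_decomposable | apply: spectral_gep].
Qed.
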